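(* Suppose that every consumer's utility function satisfies the utility assumption stated in the context, that the joint probability distribution of the intermittent supply process $\mathbf{s}$ is absolutely continuous with compact support, and that every consumer type $(k,R,q)\in\Theta$ satisfies $R\ge c_0$. Let the types of all consumers $\boldsymbol{\theta}=\{\theta_i\}_{i\in[0,1]}$ be given, and consider the market mechanism $(\pi^*,\boldsymbol{\zeta})$, where $\pi^*=(\sigma^*,\phi)$ consists of the EDF inter-class policy $\sigma^*$ and an arbitrary feasible intra-class policy $\phi\in\Phi(\sigma^* )$, and $\boldsymbol{\zeta}$ is the marginal cost pricing scheme. Then there exists a unique market equilibrium under $(\pi^*,\boldsymbol{\zeta})$, namely $(\mathbf{x}^*,\boldsymbol{\zeta}(\mathbf{x}^* ))$, and it maximizes the social welfare. Here $\mathbf{x}^*$ is the truth-telling aggregate demand bundle $$x_j^*=\sum_{\theta=(k,R,q)\in\Theta}q\,\rho(\theta)\,\mathbf{1}_{\{j=k\}},\qquad j=1,\dots,N.$$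
   Context: Fix $N\ge1$ and a price $c_0>0$ of firm supply. The intermittent supply is a random process $\mathbf{s}=(s_0,\dots,s_{N-1})$, each $s_k$ taking values in an interval $\mathcal{S}\subset\mathbb{R}_+$. Consumers. There is a continuum of consumers $i\in[0,1]$ with Lebesgue measure $\eta$. Consumer $i$ has type $\theta_i=(k_i,R_i,q_i)$ in a finite set $\Theta$: deadline $k_i\in\{1,\dots,N\}$, marginal utility $R_i\ge0$, maximum demand $q_i>0$; $\rho(\theta)$ is the fraction ($\eta$-measure) of consumers of type $\theta$, $\sum_\theta\rho(\theta)=1$. Utility assumption: a consumer of type $\theta_i$ derives utility $U_{\theta_i}(y)$ from the total energy $y$ received by her deadline $k_i$, where $U_{\theta_i}:\mathbb{R}_+\to\mathbb{R}_+$ is non-negative and non-decreasing on $[0,q_i]$, $U_{\theta_i}(y)\le yR_i$ for all $y\in[0,q_i]$, $R_i=U_{\theta_i}(q_i)/q_i$, and $U_{\theta_i}(y)=U_{\theta_i}(q_i)$ for all $y\ge q_i$. Let $Q=\max_{(k,R,q)\in\Theta}q$. An action is $\mathbf{a}\in\mathcal{A}=\{\mathbf{a}\in\mathbb{R}_+^N:\sum_k a_k\le Q\}$, where $a_k$ is the energy guaranteed delivery by deadline $k$. A strategy is a map $\varphi:\Theta\to\mathcal{A}$. The truth-telling strategy $\varphi^*$ maps $\theta=(k,R,q)$ to $\mathbf{a}^*$ with $a^*_k=q$, $a^*_j=0$ for $j\ne k$. A strategy profile $\{\varphi_i\}$ (with $i\mapsto\varphi_i(\theta_i)$ Lebesgue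 integrable) yields aggregate demand $\mathbf{x}=\int_{[0,1]}\varphi_i(\theta_i)\,\eta(di)\in\mathbb{R}_+^N$; a single consumer's action does not affect $\mathbf{x}$. Inter-class scheduling. Given $\mathbf{x}$, set $\mathbf{z}_0=\mathbf{x}$, $\mathbf{z}_{k+1}=\mathbf{z}_k-\mathbf{u}_k-\mathbf{v}_k$ for $k=0,\dots,N-1$, where $\mathbf{u}_k,\mathbf{v}_k\in\mathbb{R}_+^N$ are intermittent and firm supply allocated to the demand classes in period $k$. Let $\mathcal{Z}_k=\{\mathbf{z}\in\mathbb{R}_+^N:z^j=0\ \forall j\le k\}$ and $\mathcal{U}_k(\mathbf{z},s)=\{(\mathbf{u},\mathbf{v})\in\mathbb{R}_+^N\times\mathbb{R}_+^N:\mathbf{1}^\top\mathbf{u}\le s,\ \mathbf{z}-\mathbf{u}-\mathbf{v}\in\mathcal{Z}_{k+1}\}$. A feasible inter-class policy $\sigma\in\Sigma(\mathbf{x})$ is a sequence of (measurable) functions $\boldsymbol{\mu}_k,\boldsymbol{\nu}_k:\mathcal{Z}_k\times\mathcal{S}\to\mathbb{R}_+^N$ with $(\boldsymbol{\mu}_k,\boldsymbol{\nu}_k)(\mathbf{z},s)\in\mathcal{U}_k(\mathbf{z},s)$ for all $(\mathbf{z},s)$, and $\mathbf{u}_k=\boldsymbol{\mu}_k(\mathbf{z}_k,s_k)$, $\mathbf{v}_k=\mathbf{v}_k^\sigma=\boldsymbol{\nu}_k(\mathbf{z}_k,s_k)$. The EDF policy $\sigma^*$ is $\mu_k^{j,*}(\mathbf{z},s)=\min\{z^j,\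 s-\sum_{i=1}^{j-1}\mu_k^{i,*}(\mathbf{z},s)\}$, $\nu_k^{j,*}(\mathbf{z},s)=(z^j-\mu_k^{j,*}(\mathbf{z},s))\mathbf{1}_{\{k=j-1\}}$. The supplier's expected firm supply cost and expected profit are $Q(\mathbf{x},\sigma)=\sum_{k=0}^{N-1}\mathbb{E}\{\mathbf{c}^\top\mathbf{v}_k^\sigma\}$, $\mathbf{c}=(c_0,\dots,c_0)$, and $J(\mathbf{x},\mathbf{p},\sigma)=\mathbf{p}^\top\mathbf{x}-Q(\mathbf{x},\sigma)$. Intra-class scheduling. Given an inter-class policy $\sigma$, an intra-class policy $\phi$ dictates how the supply made available to each class by $\sigma$ is allocated across the consumers within that class. It specifies, for every $i$, $\mathbf{x}$, $\mathbf{a}$ and period $k$, random vectors $\boldsymbol{\lambda}_{k,i}(\mathbf{x},\mathbf{a})\in\mathbb{R}_+^N$ (depending on the supply realization), where $\lambda^j_{k,i}(\mathbf{x},\mathbf{a})$ is the energy delivered in period $k$ to consumer $i$ towards satisfying her demand $a_j$ (so $\sum_{k=0}^{N-1}\lambda^j_{k,i}(\mathbf{x},\mathbf{a})\le a_j$). It is feasible, $\phi\in\Phi(\sigma)$, if: (1) $\lambda^j_{k,i}(\mathbf{x},\mathbf{a})=0$ whenever $a_j=0$; (2) $\lambda^j_{k,i}(\mathbf{x},\mathbf{a})=0$ for $j\le k$; (3) the supply allocated to class $j$ in period $k$ is fully used by that class: $\int_{[0,1]}\lambda^j_{k,i}\,\eta(di)=u_k^j+v_k^j$ for $0\le k<j\le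 N$ (each consumer's $\lambda^j_{k,i}$ evaluated at her action, the actions aggregating to $\mathbf{x}$), and energy is delivered from class $j$ only when made available to it: for $k<j-1$, if $u_k^j+v_k^j=0$ then $\lambda^j_{k,i}(\mathbf{x},\mathbf{a})=0$ for every $i\in[0,1]$ and every $\mathbf{a}\in\mathcal{A}$; (4) with $\omega^\pi_{k,i}(\mathbf{x},\mathbf{a})=\sum_{t=0}^{k-1}\sum_{j=1}^N\lambda^j_{t,i}(\mathbf{x},\mathbf{a})$, one has $\sum_{t=1}^k a_t\le\omega^\pi_{k,i}(\mathbf{x},\mathbf{a})\le\sum_{t=1}^N a_t$ with probability one for $k=1,\dots,N$. A feasible scheduling policy is a pair $\pi=(\sigma,\phi)$ of feasible inter- and intra-class policies. Prices and payoffs. A pricing scheme $\boldsymbol{\kappa}$ maps $\mathbf{x}\in\mathbb{R}_+^N$ to a price bundle in $\mathcal{P}=\{\mathbf{p}\in\mathbb{R}_+^N:p_1\ge\cdots\ge p_N\}$. Consumer $i$'s expected payoff (surplus) is $V_i^\pi(\theta_i,\varphi_i,\mathbf{x},\boldsymbol{\kappa})=\mathbb{E}\{U_{\theta_i}(\omega^\pi_{k_i,i}(\mathbf{x},\mathbf{a}))\}-\boldsymbol{\kappa}(\mathbf{x})^\top\mathbf{a}$ with $\mathbf{a}=\varphi_i(\theta_i)$. A strategy $\varphi_i$ is dominant for consumer $i$ if $V_i^\pi(\theta_i,\varphi_i,\mathbf{x},\boldsymbol{\kappa})\ge V_i^\pi(\theta_i,\varphi_i',\mathbf{x},\boldsymbol{\kappa})$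 for all $\varphi_i'$ and all $\mathbf{x}\in\mathbb{R}_+^N$. The residual process is $\xi_0=0$, $\xi_{k+1}=\max\{0,\xi_k\}+s_k-x_{k+1}$ for $k=0,\dots,N-1$, and the marginal cost pricing scheme is $$\zeta_k(\mathbf{x})=c_0\Big[\mathbb{P}(\xi_k\le0)+\sum_{t=k+1}^N\mathbb{P}(\xi_k>0,\dots,\xi_{t-1}>0,\xi_t\le0)\Big],\qquad k=1,\dots,N.$$ Market equilibrium. Given the types of all consumers, a pair $(\mathbf{x},\mathbf{p})$ is a market equilibrium under a mechanism $(\pi,\boldsymbol{\kappa})$, $\pi=(\sigma,\phi)$, if (i) it is a dominant strategy for every consumer to be truth-telling under $(\pi,\boldsymbol{\kappa})$ and the resulting (truth-telling) aggregate demand bundle is $\mathbf{x}$; and (ii) $\mathbf{p}=\boldsymbol{\kappa}(\mathbf{x})$, and the bundle $\mathbf{x}$ together with the scheduling policy $\pi$ maximizes the price-taking supplier's expected profit at $\mathbf{p}$, i.e. $J(\mathbf{x},\mathbf{p},\sigma)\ge J(\mathbf{y},\mathbf{p},\sigma')$ for all $\mathbf{y}\in\mathbb{R}_+^N$, $\sigma'\in\Sigma(\mathbf{y})$. Social welfare. It is the sum of aggregate consumer surplus and supplier expected profit; since payments cancel, for an action profile $\{\mathbf{a}^{(i)}\}$ with aggregate $\mathbf{x}$ and a feasible scheduling policy $\pi=(\sigma,\phi)$ it equals $\int_{[0,1]}\mathbb{E}\{U_{\theta_i}(\omega^\pi_{k_i,i}(\mathbf{x},\mathbf{a}^{(i)}))\}\,\eta(di)-Q(\mathbf{x},\sigma)$.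 An equilibrium maximizes social welfare if the welfare it attains (truth-telling actions, scheduling policy $\pi^*$) is at least that of any action profile and any feasible scheduling policy. *)

(* Defs.v *)
From HB Require Import structures.
From mathcomp Require Import all_boot all_order all_algebra finmap.
From mathcomp Require Import all_classical all_reals all_analysis.

Set Implicit Arguments.
Unset Strict Implicit.
Unset Printing Implicit Defensive.

Import Order.TTheory GRing.Theory Num.Theory numFieldNormedType.Exports.

Local Open Scope classical_set_scope.
Local Open Scope ring_scope.

(* Indexing: demand class j (with deadline j, 1 <= j <= N) is coordinate j - 1
   of an N-tuple, while periods k = 0, ..., N - 1 and consumer deadlines
   1, ..., N keep their usual values.  Period k is thus coordinate k of a supply
   path, and class j : 'I_N is still open in period k iff k <= j. *)

Section vectors.
Context {R : realType} {N : nat}.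
Implicit Types a b x : N.-tuple R.

Definition nonneg_vec a : Prop := forall j : 'I_N, 0 <= tnth a j.

Definition subv a b : N.-tuple R := [tuple tnth a j - tnth b j | j < N].

Definition dotv a b : R := \sum_(j < N) tnth a j * tnth b j.

Definition price_bundle (p : N.-tuple R) : Prop :=
  nonneg_vec p /\ forall i j : 'I_N, (i <= j)%N -> tnth p j <= tnth p i.

End vectors.

(* N-dimensional Lebesgue measure, as an iterated product measure; `\x` is the
   library's product of two set functions. *)
Fixpoint lebesgue_tuple (R : realType) (n : nat) :
    set (n.-tuple R) -> \bar R :=
  match n return set (n.-tuple R) -> \bar R with
  | 0 => \d_[tuple]
  | m.+1 => fun A => (lebesgue_measure \x @lebesgue_tuple R m)%E
              [set p : R * m.-tuple R | A [tuple of p.1 :: p.2]]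
  end.

(* Topological support of the law of X; tuples carry no topology in the library,
   so R^N is topologised as the space of row vectors. *)
Definition law_support (R : realType) d (Omega : measurableType d)
    (P : probability Omega R) (N : nat) (X : {RV P >-> N.-tuple R}) :
    set 'rV[R]_N :=
  [set y | forall U : set 'rV[R]_N, open U -> U y ->
     (0 < P [set w | U (\row_j tnth (X w) j)])%E].

(* The real line with the Lebesgue (completed Borel) sigma-algebra; consumers
   are the points of `[0, 1], weighted by the Lebesgue measure eta. *)
Definition consumer (R : realType) : Type :=
  caratheodory_type (@wlength R idfun)^*%mu.
HB.instance Definition _ (R : realType) := Measurable.on (consumer R).

Definition eta (R : realType) : set (consumer R) -> \bar R :=
  @completed_lebesgue_measure R.
HB.instance Definition _ (R : realType) := Measure.on (@eta R).
HB.instance Definition _ (R : realType) := SigmaFiniteMeasure.on (@eta R).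
Arguments eta {R}.

Definition consumers (R : realType) : set (consumer R) :=
  [set i | 0 <= (i : R) <= 1].
Arguments consumers {R}.

(* A consumer type (k, R, q). *)
Definition ctype (R : realType) : Type := (nat * R * R)%type.
HB.instance Definition _ (R : realType) := Choice.on (ctype R).

Definition deadline (R : realType) (t : ctype R) : nat := t.1.1.
Definition marg_utility (R : realType) (t : ctype R) : R := t.1.2.
Definition max_demand (R : realType) (t : ctype R) : R := t.2.

Definition type_wf (R : realType) (N : nat) (t : ctype R) : Prop :=
  [/\ (1 <= deadline t <= N)%N, 0 <= marg_utility t & 0 < max_demand t].

(* Only the values of u on [0, +oo[ are constrained (and used). *)
Definition utility_assumption (R : realType) (t : ctype R) (u : R -> R) : Prop :=
  [/\ forall y, 0 <= y -> 0 <= u y,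
      forall y y', 0 <= y -> y <= y' -> y' <= max_demand t -> u y <= u y',
      forall y, 0 <= y -> y <= max_demand t -> u y <= y * marg_utility t,
      marg_utility t = u (max_demand t) / max_demand t
    & forall y, max_demand t <= y -> u y = u (max_demand t)].

Section demand.
Context {R : realType} {N : nat}.
Variable Theta : {fset ctype R}.

Definition action : set (N.-tuple R) :=
  [set a | nonneg_vec a /\
     \sum_(j < N) tnth a j <= \big[Num.max/0]_(t <- Theta) max_demand t].

Definition strategy (phi : ctype R -> N.-tuple R) : Prop :=
  forall t, t \in Theta -> action (phi t).

Definition truthful (t : ctype R) : N.-tuple R :=
  [tuple if j.+1 == deadline t then max_demand t else 0 | j < N].

Definition type_profile (theta : consumer R -> ctype R) : Prop :=
  (forall i, consumers i -> theta i \in Theta) /\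
  (forall t, measurable [set i | consumers i /\ theta i = t]).

Definition rho (theta : consumer R -> ctype R) (t : ctype R) : R :=
  fine (eta [set i | consumers i /\ theta i = t]).

(* `act i` is the action phi_i(theta_i) taken by consumer i. *)
Definition action_profile (act : consumer R -> N.-tuple R) : Prop :=
  (forall i, consumers i -> action (act i)) /\
  (forall j : 'I_N, eta.-integrable consumers (fun i => (tnth (act i) j)%:E)).

Definition aggregate (act : consumer R -> N.-tuple R) (x : N.-tuple R) : Prop :=
  forall j : 'I_N, (\int[eta]_(i in consumers) (tnth (act i) j)%:E)%E
                   = (tnth x j)%:E.

Definition truthful_demand (theta : consumer R -> ctype R) : N.-tuple R :=
  [tuple \sum_(t <- Theta)
     max_demand t * rho theta t * (j.+1 == deadline t)%:R | j < N].

End demand.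
Arguments action {R N} Theta.
Arguments strategy {R N} Theta phi.
Arguments truthful {R} N t.
Arguments truthful_demand {R} N Theta theta.

Section inter_class.
Context {R : realType} {N : nat}.
Implicit Types (z x : N.-tuple R) (path : N.-tuple R).

Record inter_policy := InterPolicy {
  inter_mu : nat -> N.-tuple R -> R -> N.-tuple R ;
  inter_nu : nat -> N.-tuple R -> R -> N.-tuple R }.

Definition Zset (k : nat) : set (N.-tuple R) :=
  [set z | nonneg_vec z /\ forall j : 'I_N, (j < k)%N -> tnth z j = 0].

Definition Uset (k : nat) (z : N.-tuple R) (s : R) :
    set (N.-tuple R * N.-tuple R) :=
  [set uv | [/\ nonneg_vec uv.1, nonneg_vec uv.2,
                \sum_(j < N) tnth uv.1 j <= s
              & Zset k.+1 (subv (subv z uv.1) uv.2)]].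

(* Policies are total functions, constrained on Z_k x S only.  The constraints
   do not involve the initial demand, so Sigma(x) is the same set for all x. *)
Definition feasible_inter (S : interval R) (sigma : inter_policy) : Prop :=
  forall k, (k < N)%N ->
    let D := [set p : N.-tuple R * R | Zset k p.1 /\ p.2 \in S] in
    [/\ measurable_fun D (fun p => inter_mu sigma k p.1 p.2),
        measurable_fun D (fun p => inter_nu sigma k p.1 p.2)
      & forall z s, Zset k z -> s \in S ->
          Uset k z s (inter_mu sigma k z s, inter_nu sigma k z s)].

Fixpoint unmet (sigma : inter_policy) x path (k : nat) : N.-tuple R :=
  if k is k'.+1 then
    let z := unmet sigma x path k' in
    subv (subv z (inter_mu sigma k' z path`_k')) (inter_nu sigma k' z path`_k')
  else x.

Definition intermittent sigma x path k : N.-tuple R :=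
  inter_mu sigma k (unmet sigma x path k) path`_k.

Definition firm sigma x path k : N.-tuple R :=
  inter_nu sigma k (unmet sigma x path k) path`_k.

(* Intermittent supply that EDF gives to the first j classes. *)
Fixpoint edf_served z (s : R) (j : nat) : R :=
  if j is j'.+1 then
    edf_served z s j' + Num.min z`_j' (s - edf_served z s j')
  else 0.

Definition edf_mu z (s : R) : N.-tuple R :=
  [tuple Num.min (tnth z j) (s - edf_served z s j) | j < N].

Definition edf_nu (k : nat) z (s : R) : N.-tuple R :=
  [tuple if k == j then tnth z j - tnth (edf_mu z s) j else 0 | j < N].

Definition edf : inter_policy := InterPolicy (fun=> edf_mu) edf_nu.

Lemma edf_servedE z s (j : nat) : (j <= N)%N ->
  edf_served z s j = \sum_(i < N | (i < j)%N) tnth (edf_mu z s) i.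
Proof.
elim: j => [|j IH] jN /=; first by rewrite big_pred0.
rewrite {1}IH 1?ltnW// [RHS](bigD1 (Ordinal jN))//= addrC; congr (_ + _).
  by apply: eq_bigl => i; rewrite ltnS -val_eqE/= ltn_neqAle andbC.
by rewrite tnth_mktuple (tnth_nth 0).
Qed.

Lemma edf_muE z s (j : 'I_N) : tnth (edf_mu z s) j =
  Num.min (tnth z j) (s - \sum_(i < N | (i < j)%N) tnth (edf_mu z s) i).
Proof. by rewrite {1}/edf_mu tnth_mktuple edf_servedE // ltnW. Qed.

Fixpoint residual x path (k : nat) : R :=
  if k is k'.+1 then Num.max 0 (residual x path k') + path`_k' - x`_k' else 0.

End inter_class.
Arguments inter_policy : clear implicits.
Arguments edf {R} N.

Section market.
Context {R : realType} {N : nat} {d : measure_display} {Omega : measurableType d}.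
Variables (P : probability Omega R) (s : {RV P >-> N.-tuple R}).
Variables (S : interval R) (c0 : R).
Variables (Theta : {fset ctype R}) (theta : consumer R -> ctype R).
Variable U : ctype R -> R -> R.

Definition firm_cost (x : N.-tuple R) (sigma : inter_policy R N) : \bar R :=
  (\sum_(k < N) 'E_P[fun w => dotv [tuple c0 | _ < N] (firm sigma x (s w) k)])%E.

Definition profit (x p : N.-tuple R) (sigma : inter_policy R N) : \bar R :=
  ((dotv p x)%:E - firm_cost x sigma)%E.

Definition zeta (x : N.-tuple R) : N.-tuple R :=
  [tuple c0 * (fine (P [set w | residual x (s w) k.+1 <= 0])
      + \sum_(k.+2 <= t < N.+1)
          fine (P [set w |
            (forall m, (k.+1 <= m < t)%N -> 0 < residual x (s w) m) /\
            residual x (s w) t <= 0])) | k < N].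

(* lam k i x a path is lambda_{k,i}(x, a) on the supply realisation path. *)
Definition intra_policy : Type :=
  nat -> consumer R -> N.-tuple R -> N.-tuple R -> N.-tuple R -> N.-tuple R.

Definition received (lam : intra_policy) (k : nat) (i : consumer R)
    (x a path : N.-tuple R) : R :=
  \sum_(t < k) \sum_(j < N) tnth (lam t i x a path) j.

(* The two measurability clauses are what the expectations and the integrals
   over consumers presuppose. *)
Record feasible_intra (sigma : inter_policy R N) (lam : intra_policy) : Prop := {
  intra_measurable : forall k i x a, (k < N)%N -> consumers i ->
    nonneg_vec x -> action Theta a ->
    measurable_fun [set: Omega] (fun w => lam k i x a (s w)) ;
  intra_jointly_measurable : forall k x act, (k < N)%N ->
    action_profile Theta act -> aggregate act x ->
    measurable_fun (consumers `*` [set: Omega])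
      (fun iw : consumer R * Omega => lam k iw.1 x (act iw.1) (s iw.2)) ;
  intra_nonneg : forall k i x a w, (k < N)%N -> consumers i ->
    nonneg_vec x -> action Theta a -> nonneg_vec (lam k i x a (s w)) ;
  intra_demand : forall i x a w (j : 'I_N), consumers i ->
    nonneg_vec x -> action Theta a ->
    \sum_(k < N) tnth (lam k i x a (s w)) j <= tnth a j ;
  intra_no_demand : forall k i x a w (j : 'I_N), (k < N)%N -> consumers i ->
    nonneg_vec x -> action Theta a ->
    tnth a j = 0 -> tnth (lam k i x a (s w)) j = 0 ;
  intra_expired : forall k i x a w (j : 'I_N), (k < N)%N -> consumers i ->
    nonneg_vec x -> action Theta a ->
    (j < k)%N -> tnth (lam k i x a (s w)) j = 0 ;
  intra_exhausts : forall k x act w (j : 'I_N), (k <= j)%N ->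
    action_profile Theta act -> aggregate act x ->
    (\int[eta]_(i in consumers) (tnth (lam k i x (act i) (s w)) j)%:E)%E
    = (tnth (intermittent sigma x (s w) k) j
       + tnth (firm sigma x (s w) k) j)%:E ;
  intra_available : forall k i x a w (j : 'I_N), (k < j)%N -> consumers i ->
    nonneg_vec x -> action Theta a ->
    tnth (intermittent sigma x (s w) k) j + tnth (firm sigma x (s w) k) j = 0 ->
    tnth (lam k i x a (s w)) j = 0 ;
  intra_guarantee : forall k i x a, (1 <= k <= N)%N -> consumers i ->
    nonneg_vec x -> action Theta a ->
    {ae P, forall w,
      \sum_(t < N | (t < k)%N) tnth a t <= received lam k i x a (s w)
        <= \sum_(t < N) tnth a t} }.

Definition payoff (lam : intra_policy) (kappa : N.-tuple R -> N.-tuple R)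
    (i : consumer R) (phi : ctype R -> N.-tuple R) (x : N.-tuple R) : \bar R :=
  let t := theta i in
  ('E_P[fun w => U t (received lam (deadline t) i x (phi t) (s w))]
   - (dotv (kappa x) (phi t))%:E)%E.

Definition dominant_strategy (lam : intra_policy)
    (kappa : N.-tuple R -> N.-tuple R) (i : consumer R)
    (phi : ctype R -> N.-tuple R) : Prop :=
  strategy Theta phi /\
  forall phi' x, strategy Theta phi' -> nonneg_vec x ->
    (payoff lam kappa i phi' x <= payoff lam kappa i phi x)%E.

Record market_equilibrium (sigma : inter_policy R N) (lam : intra_policy)
    (kappa : N.-tuple R -> N.-tuple R) (x p : N.-tuple R) : Prop := {
  meq_quantity : nonneg_vec x ;
  meq_price_bundle : price_bundle p ;
  meq_truthful : forall i, consumers i ->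
    dominant_strategy lam kappa i (truthful N) ;
  meq_demand : aggregate (fun i => truthful N (theta i)) x ;
  meq_price : p = kappa x ;
  meq_inter : feasible_inter S sigma ;
  meq_intra : feasible_intra sigma lam ;
  meq_supply : forall y sigma', nonneg_vec y -> feasible_inter S sigma' ->
    (profit y p sigma' <= profit x p sigma)%E }.

Definition welfare (act : consumer R -> N.-tuple R) (x : N.-tuple R)
    (sigma : inter_policy R N) (lam : intra_policy) : \bar R :=
  (\int[eta]_(i in consumers)
      'E_P[fun w => U (theta i)
             (received lam (deadline (theta i)) i x (act i) (s w))]
   - firm_cost x sigma)%E.

Definition maximizes_welfare (act : consumer R -> N.-tuple R) (x : N.-tuple R)
    (sigma : inter_policy R N) (lam : intra_policy) : Prop :=
  forall act' x' sigma' lam',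
    action_profile Theta act' -> aggregate act' x' ->
    feasible_inter S sigma' -> feasible_intra sigma' lam' ->
    (welfare act' x' sigma' lam' <= welfare act x sigma lam)%E.

End market.
Arguments intra_policy : clear implicits.

(* Main.v *)
(* For a path of supplies and a demand bundle x, say that there is a shortage
   after period n when the residual process is nonpositive at some m >= n; the
   price of class k is c0 times the probability of a shortage after its deadline,
   so everything reduces to inequalities along each supply path.  Shortages are
   nonincreasing in n, and EDF buys exactly (class k having deadline k + 1)
   sum_k [shortage after k + 1] (x_k - s_k), while by weak duality (the shortage
   indicators are dual variables) any policy facing any demand y buys at least
   sum_k [shortage after k + 1] (y_k - s_k).  Hence the prices form a subgradient
   at x of the minimal expected cost, which gives the supplier's optimality, and
   the same duality applied to the energy that reaches the consumers by their
   deadlines gives welfare optimality after exchanging the two integrals.  Truth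
   telling is dominant because EDF serves a class before the deadline of an earlier
   one only if no residual in between is nonpositive: on paths where a consumer's
   deadline is followed by a shortage, energy from a later class reaches her early
   only if that class is charged as well. *)

Require Import Defs.
From mathcomp Require Import all_boot all_order all_algebra finmap.
From mathcomp Require Import all_classical all_reals all_analysis.
From mathcomp Require Import measurable_realfun.
From mathcomp Require Import ring lra.
Import Order.TTheory GRing.Theory Num.Theory numFieldNormedType.Exports.
Local Open Scope classical_set_scope.
Local Open Scope ring_scope.
Set Implicit Arguments.
Unset Strict Implicit.

(** * EDF along a supply path *)

Section pathwise.
Context {R : realType} {N : nat}.
Implicit Types (x z path a : N.-tuple R) (sigma : inter_policy R N).

Lemma nth_nonneg a i : nonneg_vec a -> 0 <= a`_i.
Proof.
move=> a0; have [iN|iN] := ltnP i N; last by rewrite nth_default ?size_tuple.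
by rewrite -(tnth_nth 0 a (Ordinal iN)).
Qed.

Lemma nth_subv a z i : (subv a z)`_i = a`_i - z`_i.
Proof.
have [iN|iN] := ltnP i N; last by rewrite !nth_default ?size_tuple ?subr0.
by rewrite -(tnth_nth 0 (subv a z) (Ordinal iN)) tnth_mktuple !(tnth_nth 0).
Qed.

(** Sequence access with default 0 makes this meaningful for every natural [j], so inductions run
    over naturals rather than ordinals. *)
Definition cumul a (j : nat) : R := \sum_(i < j) a`_i.

Lemma cumulS a j : cumul a j.+1 = cumul a j + a`_j.
Proof. by rewrite /cumul big_ord_recr. Qed.

Lemma cumul_mono a j k : nonneg_vec a -> (j <= k)%N -> cumul a j <= cumul a k.
Proof.
move=> a0; elim: k => [|k IH]; first by rewrite leqn0 => /eqP ->.
rewrite leq_eqVlt ltnS => /predU1P[->//|/IH /le_trans]; apply.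
by rewrite cumulS lerDl nth_nonneg.
Qed.

Lemma cumul_ge0 a j : nonneg_vec a -> 0 <= cumul a j.
Proof. by move=> a0; apply: sumr_ge0 => i _; exact: nth_nonneg. Qed.

(** Greedy service in deadline order either exhausts the supply or meets all demand of the first [j]
    classes. *)
Lemma edf_served_min z (s : R) j : nonneg_vec z -> 0 <= s ->
  edf_served z s j = Num.min s (cumul z j).
Proof.
move=> z0 s0; elim: j => [|j /= ->]; first by rewrite /cumul big_ord0 min_r.
rewrite cumulS; have := nth_nonneg j z0; move: z`_j (cumul z j) => zj A zj0.
by case: (leP s A) => ?; case: (leP s (A + zj)) => ?; case: leP => ?; lra.
Qed.

Lemma nth_edf_mu z (s : R) j : (j < N)%N -> nonneg_vec z -> 0 <= s ->
  (edf_mu z s)`_j = Num.min z`_j (s - Num.min s (cumul z j)).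
Proof.
move=> jN z0 s0; rewrite -(tnth_nth 0 (edf_mu z s) (Ordinal jN)) tnth_mktuple.
by rewrite edf_served_min// (tnth_nth 0).
Qed.

Lemma edf_mu_ge0 z (s : R) : nonneg_vec z -> 0 <= s -> nonneg_vec (edf_mu z s).
Proof.
move=> z0 s0 j; rewrite (tnth_nth 0) nth_edf_mu// le_min nth_nonneg//.
by rewrite subr_ge0 ge_min lexx.
Qed.

Lemma edf_mu_le z (s : R) (j : 'I_N) : tnth (edf_mu z s) j <= tnth z j.
Proof. by rewrite tnth_mktuple ge_min lexx. Qed.

Lemma edf_Uset k z (s : R) : Zset k z -> 0 <= s ->
  Uset k z s (edf_mu z s, edf_nu k z s).
Proof.
move=> [z0 zk] s0; split => /=.
- exact: edf_mu_ge0.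
- by move=> j; rewrite tnth_mktuple; case: ifP => // _; rewrite subr_ge0 edf_mu_le.
- rewrite (_ : \sum_(j < N) _ = edf_served z s N); last first.
    by rewrite edf_servedE//; apply: eq_bigl => i; rewrite ltn_ord.
  by rewrite edf_served_min// ge_min lexx.
- split=> j; rewrite !tnth_mktuple.
    have := edf_mu_le z s j; rewrite !tnth_mktuple.
    by case: ifP => _; rewrite ?subr0 ?subr_ge0// subrr.
  rewrite ltnS leq_eqVlt => /predU1P[->|jk]; first by rewrite eqxx; ring.
  (* An expired class has no demand left, and the supply remaining for it is nonnegative, so the
     minimum in [edf_mu] is 0. *)
  rewrite gtn_eqF// zk// subr0 sub0r min_l ?oppr0// subr_ge0.
  by rewrite edf_served_min// ge_min lexx.
Qed.

Lemma unmet_Zset (S : interval R) sigma x path k : feasible_inter S sigma ->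
  nonneg_vec x -> (forall j, tnth path j \in S) -> (k <= N)%N ->
  Zset k (unmet sigma x path k).
Proof.
move=> fs x0 pS; elim: k => [|k IH] kN; first by split.
have [_ _ sU] := fs k kN.
have pk : path`_k \in S by rewrite -(tnth_nth 0 path (Ordinal kN)).
have [_ _ _ uZ] := sU _ _ (IH (ltnW kN)) pk; exact: uZ.
Qed.

Lemma policy_Uset (S : interval R) sigma x path k : feasible_inter S sigma ->
  nonneg_vec x -> (forall j, tnth path j \in S) -> (k < N)%N ->
  Uset k (unmet sigma x path k) path`_k
    (intermittent sigma x path k, firm sigma x path k).
Proof.
move=> fs x0 pS kN; have [_ _ ] := fs k kN; apply.
  exact: unmet_Zset fs x0 pS (ltnW kN).
by rewrite -(tnth_nth 0 path (Ordinal kN)).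
Qed.


(* Surplus [e] is carried into a period with supply [s] and closing demand [c],
   while [D] units are due later. *)
Lemma excess_supply (e s D c : R) : 0 <= e -> 0 <= s -> 0 <= D -> 0 <= c ->
  Num.max 0 (D + c - e) - Num.min s (Num.max 0 (D + c - e))
    - (Num.max 0 (c - e) - Num.min (Num.max 0 (c - e)) s)
  = Num.max 0 (D - Num.max 0 (e + s - c)).
Proof.
move=> e0 s0 D0 c0.
case: (leP 0 (c - e)) => ?; case: (leP 0 (D + c - e)) => ?;
  case: (leP 0 (e + s - c)) => ?; repeat case: leP => ?; lra.
Qed.

(** EDF works through the classes in deadline order, so only the total work done ahead of schedule
    matters. That surplus is the positive part of the residual, and it is subtracted from the demand
    of classes [k] to [j - 1]. The induction step is [excess_supply], with class [k] as the closing
    demand. *)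
Lemma edf_cumul_unmet x path k : nonneg_vec x -> nonneg_vec path -> (k <= N)%N ->
  Zset k (unmet (edf N) x path k) /\
  forall j, (k <= j <= N)%N -> cumul (unmet (edf N) x path k) j =
    Num.max 0 (cumul x j - cumul x k - Num.max 0 (residual x path k)).
Proof.
move=> x0 p0; elim: k => [|k IH] kN.
  split=> // j _; rewrite {3}/cumul big_ord0 subr0 maxxx subr0 max_r//.
  exact: cumul_ge0.
have [Zk cE] := IH (ltnW kN); set z := unmet _ _ _ k in Zk cE *.
have s0 := nth_nonneg k p0; have [z0 zk] := Zk.
have [_ _ _ /= Zk1] := edf_Uset Zk s0.
split=> // j /andP[kj jN].
set s := path`_k in s0 Zk1 *; set xi := residual x path k in cE *.
have zcum i : (i <= k)%N -> cumul z i = 0.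
  move=> ik; rewrite /cumul big1// => m _.
  have mN : (m < N)%N by rewrite (leq_trans _ kN)// ltnS (leq_trans _ ik)// ltnW.
  rewrite -(tnth_nth 0 z (Ordinal mN)) zk//=.
  exact: leq_trans (ltn_ord m) ik.
have nuE i : (i < N)%N -> (edf_nu k z s)`_i =
    if k == i then z`_k - Num.min z`_k s else 0.
  move=> iN; rewrite -(tnth_nth 0 (edf_nu k z s) (Ordinal iN)) tnth_mktuple.
  case: eqP => //= ki; rewrite !(tnth_nth 0)/= nth_edf_mu// -ki zcum//.
  by rewrite (min_r s0) subr0.
(* Written as an increment, the share of a class telescopes when summed over classes. *)
have muE i : (i < N)%N -> (edf_mu z s)`_i =
    Num.min s (cumul z i.+1) - Num.min s (cumul z i).
  move=> iN; rewrite nth_edf_mu// cumulS.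
  have := nth_nonneg i z0; move: z`_i (cumul z i) => zj A zj0.
  by case: (leP s A) => ?; case: (leP s (A + zj)) => ?; case: leP => ?; lra.
(* Up to [i], period [k] removes the intermittent supply usable by these classes and the firm supply
   that completes class [k]. *)
have cE1 i : (k < i <= N)%N -> cumul (unmet (edf N) x path k.+1) i =
    cumul z i - Num.min s (cumul z i) - (z`_k - Num.min z`_k s).
  move=> /andP[+ iN]; elim: i iN => // i IHi iN.
  rewrite ltnS leq_eqVlt cumulS /= -/z !nth_subv -/s muE// nuE// => /predU1P[ki|ki].
    rewrite -ki eqxx {1}/cumul big1 => [|m _]; last first.
      have mk : (m < k.+1)%N by exact: leqW (ltn_ord m).
      have mN : (m < N)%N by rewrite (leq_trans mk).
      by rewrite -(tnth_nth 0 (subv _ _) (Ordinal mN)) Zk1.2.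
    by rewrite cumulS (zcum k)// (min_r s0); ring.
  by rewrite (IHi (ltnW iN) ki) ltn_eqF// cumulS; ring.
rewrite cE1 ?kj// cE ?jN ?andbT ?(ltnW kj)//.
have zkE : z`_k = cumul z k.+1 by rewrite cumulS zcum ?add0r.
rewrite zkE cE ?leqnSn//=.
have D0 : 0 <= cumul x j - cumul x k.+1 by rewrite subr_ge0 cumul_mono.
have e0 : 0 <= Num.max 0 xi by rewrite le_max lexx.
have := excess_supply e0 s0 D0 (nth_nonneg k x0); rewrite cumulS.
have -> : cumul x j - (cumul x k + x`_k) + x`_k = cumul x j - cumul x k by ring.
have -> : cumul x k + x`_k - cumul x k = x`_k by ring.
by move=> <-.
Qed.

(** By [edf_cumul_unmet], class [k] enters its last period with its demand minus the surplus, cut at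
    0. What the supply of that period cannot cover is the negative part of the next residual. *)
Lemma edf_firmE x path k (j : 'I_N) : nonneg_vec x -> nonneg_vec path ->
  (k < N)%N -> tnth (firm (edf N) x path k) j =
    if k == j then Num.max 0 (- residual x path k.+1) else 0.
Proof.
move=> x0 p0 kN; rewrite tnth_mktuple; case: eqP => // kj.
have [[z0 zk] cE] := edf_cumul_unmet x0 p0 (ltnW kN).
have s0 := nth_nonneg k p0.
rewrite !(tnth_nth 0) -kj nth_edf_mu// cE ?leqnn ?(ltnW kN)// subrr.
have := cE k.+1; rewrite cumulS cE ?leqnn ?(ltnW kN)// subrr leqnSn => /(_ kN) => zE.
have {}zE : (unmet (edf N) x path k)`_k =
    Num.max 0 (x`_k - Num.max 0 (residual x path k)).
  have e0 : 0 <= Num.max 0 (residual x path k) by rewrite le_max lexx.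
  move: zE; rewrite cumulS sub0r max_l ?oppr_le0// add0r.
  by move=> ->; congr (Num.max 0 (_ - _)); ring.
rewrite zE /=.
have := nth_nonneg k x0; move: x`_k path`_k s0 (residual x path k) => c s s0 xi c0.
have : 0 <= Num.max 0 xi by rewrite le_max lexx.
move: (Num.max 0 xi) => e e0.
rewrite sub0r (@max_l _ _ 0 (- e)) ?oppr_le0// (min_r s0) subr0.
case: (leP 0 (c - e)) => ?; repeat case: leP => ?; lra.
Qed.

(* EDF reaches class j only once every earlier class is served, so that the
   residual process stays positive until the deadline of class j - 1. *)
Lemma edf_early_residual x path k (j : 'I_N) m : nonneg_vec x ->
  nonneg_vec path -> (k < j)%N ->
  0 < tnth (intermittent (edf N) x path k) j -> (k < m <= j)%N ->
  0 < residual x path m.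
Proof.
move=> x0 p0 kj mu0 /andP[km mj].
have kN : (k < N)%N by rewrite (ltn_trans kj).
(* The strengthened claim is stable under induction on [m]: the surplus exceeds all demand of
   classes [m] to [j - 1], so serving class [m] on time still leaves enough for the others. *)
suff : cumul x j - cumul x m < residual x path m.
  by apply: le_lt_trans; rewrite subr_ge0 cumul_mono.
have [[z0 zk] cE] := edf_cumul_unmet x0 p0 (ltnW kN).
have s0 := nth_nonneg k p0.
have {mu0}s_gt : cumul x j - cumul x k < Num.max 0 (residual x path k) + path`_k.
  move: mu0; rewrite (tnth_nth 0) nth_edf_mu// cE ?(ltnW kj) ?(ltnW (ltn_ord j))//.
  rewrite lt_min => /andP[_].
  move: (Num.max 0 (residual x path k)) => e.
  move: (cumul x j - cumul x k) => D.
  by case: (leP 0 (D - e)) => ?; [case: (leP _ (D - e))|case: (leP _ 0)] => ?; lra.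
elim: m km mj => // m IH; rewrite ltnS leq_eqVlt => /predU1P[<-|km] mj.
  by rewrite /= cumulS; lra.
have := IH km (ltnW mj); have := nth_nonneg m p0 => /=; rewrite cumulS.
by case: (leP 0 (residual x path m)) => ?; lra.
Qed.

End pathwise.

(** * Shortages and firm supply *)

Section shortage.
Context {R : realType} {N : nat}.
Implicit Types (x z path a : N.-tuple R) (sigma : inter_policy R N).

(** Being Boolean, it coerces to a 0-1 dual variable in [R]. The range of [m] stops at [N], hence
    the value is false at [N.+1]. *)
Definition shortage x path (n : nat) : bool :=
  [exists m : 'I_N.+1, (n <= m)%N && (residual x path m <= 0)].

Lemma shortageP x path n : reflect
  (exists m, [/\ (n <= m)%N, (m <= N)%N & residual x path m <= 0])
  (shortage x path n).
Proof.
apply: (iffP existsP) => [[m /andP[nm mx]]|[m [nm mN mx]]].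
  by exists m; split=> //; rewrite -ltnS.
by exists (Ordinal (n:=N.+1) (m:=m) mN); rewrite nm.
Qed.

Lemma shortage_mono x path m n : (m <= n)%N ->
  shortage x path n -> shortage x path m.
Proof.
move=> mn /shortageP[k [nk kN kx]]; apply/shortageP; exists k; split=> //.
exact: leq_trans nk.
Qed.

Lemma shortage_last x path : shortage x path N.+1 = false.
Proof.
by apply/negbTE/negP => /shortageP[m [h1 h2 _]]; move: h2; rewrite leqNgt h1.
Qed.

Lemma shortageS x path n : 0 < residual x path n ->
  shortage x path n = shortage x path n.+1.
Proof.
move=> xn; apply/idP/idP; last exact: shortage_mono.
move=> /shortageP[k [+ kN kx]]; rewrite leq_eqVlt => /predU1P[kn|nk].
  by move: xn; rewrite kn ltNge kx.
by apply/shortageP; exists k.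
Qed.

(** A witness of the shortage cannot lie where the residual is positive, so it lies at [n] or
    later. *)
Lemma shortage_cross x path m n : (m <= n)%N -> (n <= N.+1)%N ->
  (forall k, (m <= k < n)%N -> 0 < residual x path k) ->
  shortage x path m -> shortage x path n.
Proof.
move=> mn nN pos /shortageP[k [mk kN kx]]; apply/shortageP; exists k; split=> //.
by rewrite leqNgt; apply/negP => kn; have := pos k; rewrite mk kn ltNge kx => /(_ isT).
Qed.

(** Summation by parts. If the next residual is positive, nothing is bought and the indicator does
    not change; otherwise the indicator is 1 and the surplus is used up. *)
Lemma edf_firm_total x path : nonneg_vec x -> nonneg_vec path ->
  \sum_(k < N) \sum_(j < N) tnth (firm (edf N) x path k) j =
  \sum_(k < N) (shortage x path k.+1)%:R * (x`_k - path`_k).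
Proof.
move=> x0 p0.
(* The dual value of the surplus entering period [k]. With the indicator at [k.+1], the last term
   vanishes by [shortage_last]; the first vanishes because the residual starts at 0. *)
pose a k : R := (shortage x path k.+1)%:R * Num.max 0 (residual x path k).
transitivity (\sum_(k < N) (Num.max 0 (- residual x path k.+1) + (a k - a k.+1))).
  rewrite [RHS]big_split/= -[X in _ = _ + X](big_mkord xpredT (fun k => a k - a k.+1)).
  under [X in _ = _ + X]eq_bigr do rewrite -opprB.
  rewrite sumrN telescope_sumr// /a shortage_last mul0r /= maxxx mulr0 subrr.
  rewrite oppr0 addr0; apply: eq_bigr => k _.
  rewrite (bigD1 k)//= edf_firmE// eqxx big1 ?addr0// => j jk.
  by rewrite edf_firmE// eq_sym val_eqE (negbTE jk).
apply: eq_bigr => k _; rewrite /a.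
have [xk|xk] := ltP 0 (residual x path k.+1).
  by rewrite -(shortageS xk) max_l ?oppr_le0 ?ltW//=; ring.
have -> : shortage x path k.+1.
  by apply/shortageP; exists k.+1; split=> //; exact: ltn_ord.
by rewrite (@max_r _ _ 0 (- _)) ?oppr_ge0//=; ring.
Qed.

(** * Weak duality for an arbitrary feasible policy *)

Section policy.
Variables (S : interval R) (sigma : inter_policy R N) (y path : N.-tuple R).
Hypothesis fs : feasible_inter S sigma.
Hypothesis y0 : nonneg_vec y.
Hypothesis pS : forall j, tnth path j \in S.

Definition delivered k (j : 'I_N) : R :=
  tnth (intermittent sigma y path k) j + tnth (firm sigma y path k) j.

Lemma delivered_ge0 k j : (k < N)%N -> 0 <= delivered k j.
Proof.
by move=> kN; have [u0 v0 _ _] := policy_Uset fs y0 pS kN; rewrite addr_ge0.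
Qed.

Lemma delivered_unmet k j : tnth (unmet sigma y path k.+1) j =
  tnth (unmet sigma y path k) j - delivered k j.
Proof. by rewrite /= !tnth_mktuple /delivered opprD addrA. Qed.

(** The unmet demand of an expired class is 0 both before and after the period. *)
Lemma delivered_expired k (j : 'I_N) : (j < k)%N -> (k < N)%N ->
  delivered k j = 0.
Proof.
move=> jk kN; have [_ zk] := unmet_Zset fs y0 pS (ltnW kN).
have [_ zk1] := unmet_Zset fs y0 pS kN.
have := delivered_unmet k j.
rewrite zk// zk1 ?(ltnW jk)// ?ltnS ?(ltnW jk)// sub0r => /eqP.
by rewrite eq_sym oppr_eq0 => /eqP.
Qed.

Lemma sum_delivered j : \sum_(k < N) delivered k j = tnth y j.
Proof.
rewrite -(big_mkord xpredT (delivered^~ j)).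
have [_ /(_ j (ltn_ord j)) zN] := unmet_Zset fs y0 pS (leqnn N).
rewrite (eq_bigr (fun k => - (tnth (unmet sigma y path k.+1) j
                              - tnth (unmet sigma y path k) j))).
  by rewrite sumrN telescope_sumr// zN sub0r opprK.
by move=> k _; rewrite delivered_unmet; ring.
Qed.

Lemma delivered_le k j : (k < N)%N -> delivered k j <= tnth y j.
Proof.
move=> kN; rewrite -sum_delivered (bigD1 (Ordinal kN))//= lerDl sumr_ge0// => i _.
exact: delivered_ge0.
Qed.

Lemma firm_ge0 k j : (k < N)%N -> 0 <= tnth (firm sigma y path k) j.
Proof. by move=> kN; have [_ v0 _ _] := policy_Uset fs y0 pS kN; exact: v0. Qed.

Lemma firm_le k j : (k < N)%N -> tnth (firm sigma y path k) j <= tnth y j.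
Proof.
move=> kN; apply: le_trans (delivered_le j kN); rewrite lerDr.
by have [u0 _ _ _] := policy_Uset fs y0 pS kN; exact: u0.
Qed.

(** Intermittent supply is limited by the path and weighted by [g >= 0]; firm supply has unit cost,
    which is at least its weight since [g <= 1]. *)
Lemma weighted_supply (g : nat -> R) : (forall k, 0 <= g k <= 1) ->
  \sum_(k < N) g k.+1 * \sum_(j < N) delivered k j <=
  \sum_(k < N) g k.+1 * path`_k +
  \sum_(k < N) \sum_(j < N) tnth (firm sigma y path k) j.
Proof.
move=> g01; rewrite -big_split/=; apply: ler_sum => k _.
have [u0 v0 us _] := policy_Uset fs y0 pS (ltn_ord k).
have /andP[g0 g1] := g01 k.+1.
by rewrite big_split/= mulrDr lerD// ?ler_wpM2l// ler_piMl// sumr_ge0.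
Qed.

(** Class [j] is served only in periods [k <= j], where the weight is at least [g j.+1]. *)
Lemma weighted_demand (g : nat -> R) : (forall k, 0 <= g k) ->
  (forall m n, (m <= n)%N -> g n <= g m) ->
  \sum_(j < N) g j.+1 * tnth y j <= \sum_(k < N) g k.+1 * \sum_(j < N) delivered k j.
Proof.
move=> g0 gmono.
under eq_bigr do rewrite -sum_delivered mulr_sumr.
rewrite exchange_big/=; apply: ler_sum => k _; rewrite mulr_sumr.
apply: ler_sum => j _; have [jk|kj] := ltnP j k.
  by rewrite delivered_expired// !mulr0.
by rewrite ler_wpM2r ?delivered_ge0// gmono.
Qed.

End policy.

End shortage.

(** * Measurability and marginal costs *)

Lemma measurable_nth (R : realType) N i :
  measurable_fun [set: N.-tuple R] (fun z => z`_i).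
Proof.
have [iN|iN] := ltnP i N.
  rewrite (_ : (fun _ => _) = (@tnth _ R ^~ (Ordinal iN))).
    exact: measurable_tnth.
  by apply/funext => z; rewrite (tnth_nth 0).
rewrite (_ : (fun _ => _) = cst 0); first exact: measurable_cst.
by apply/funext => z /=; rewrite nth_default// size_tuple.
Qed.

Lemma integrable_bounded d (T : measurableType d) (R : realType)
    (mu : {finite_measure set T -> \bar R}) (f : T -> R) (C : R) :
  measurable_fun [set: T] f -> (forall x, `|f x| <= C) ->
  mu.-integrable [set: T] (EFin \o f).
Proof.
move=> mf fC; apply: measurable_bounded_integrable => //.
  by rewrite -ge0_fin_numE// fin_num_measure.
by exists C; split; [exact: num_real|move=> M CM x _; exact: le_trans (fC x) (ltW CM)].
Qed.

Lemma measurable_le d (T : measurableType d) (R : realType) (f g : T -> R) :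
  measurable_fun [set: T] f -> measurable_fun [set: T] g ->
  measurable [set x | f x <= g x].
Proof.
by move=> mf mg; rewrite -[X in measurable X]setTI; exact: measurable_fun_le.
Qed.

Lemma measurable_Zset (R : realType) N k : measurable (@Zset R N k).
Proof.
rewrite (_ : Zset k = \bigcap_(j in [set: 'I_N])
   [set z | 0 <= tnth z j] `&`
   \bigcap_(j in [set j : 'I_N | (j < k)%N]) [set z | tnth z j = 0]).
  apply: measurableI; apply: fin_bigcap_measurable => //= j _.
    by apply: (measurable_le (f := cst 0)) => //; exact: measurable_tnth.
  rewrite (_ : [set _ | _] = (@tnth N R ^~ j) @^-1` [set 0])//.
  rewrite -[X in measurable X]setTI.
  exact: (measurable_tnth j measurableT (measurable_set1 0)).
apply/seteqP; split=> z /= [h1 h2].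
  by split=> [j _|j]; [exact: h1|exact: h2].
by split=> j; [exact: h1|exact: h2].
Qed.

Lemma measurable_edf_served (R : realType) N j :
  measurable_fun [set: N.-tuple R * R] (fun p => edf_served p.1 p.2 j).
Proof.
elim: j => [|j IH] /=; first exact: measurable_cst.
apply: measurable_funD => //; apply: measurable_minr.
  exact: (measurableT_comp (@measurable_nth R N j)).
exact: measurable_funB.
Qed.

Lemma measurable_edf_mu (R : realType) N :
  measurable_fun [set: N.-tuple R * R] (fun p => edf_mu p.1 p.2).
Proof.
apply/measurable_fun_tnthP => j.
rewrite (_ : _ \o _ = (fun p => Num.min (tnth p.1 j) (p.2 - edf_served p.1 p.2 j))).
  apply: measurable_minr; first exact: (measurableT_comp (measurable_tnth j)).
  by apply: measurable_funB => //; exact: measurable_edf_served.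
by apply/funext => p /=; rewrite tnth_mktuple.
Qed.

Lemma edf_feasible (R : realType) N (S : interval R) :
  (forall r, r \in S -> 0 <= r) -> feasible_inter S (edf N).
Proof.
move=> S0 k kN D; split.
- by apply: measurable_funTS; exact: measurable_edf_mu.
- apply: measurable_funTS; apply/measurable_fun_tnthP => j.
  rewrite (_ : _ \o _ = if k == j
      then fun p => tnth p.1 j - tnth (edf_mu p.1 p.2) j else cst 0); last first.
    by apply/funext => p /=; rewrite tnth_mktuple; case: ifP.
  case: ifP => _; last exact: measurable_cst.
  apply: measurable_funB; apply: (measurableT_comp (measurable_tnth j)) => //.
  exact: measurable_edf_mu.
- by move=> z s Zz sS; exact: edf_Uset (S0 _ sS).
Qed.

Section supply.
Context {R : realType} {N : nat} {d : measure_display} {Omega : measurableType d}.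
Variables (P : probability Omega R) (s : {RV P >-> N.-tuple R}).
Implicit Types (x y : N.-tuple R) (sigma : inter_policy R N).

Lemma measurable_supply k : measurable_fun [set: Omega] (fun w => (s w)`_k).
Proof. exact: (measurableT_comp (@measurable_nth R N k)). Qed.

Lemma measurable_residual x k :
  measurable_fun [set: Omega] (fun w => residual x (s w) k).
Proof.
elim: k => [|k IH] /=; first exact: measurable_cst.
apply: measurable_funB; last exact: measurable_cst.
by apply: measurable_funD; [exact: measurable_maxr|exact: measurable_supply].
Qed.

Lemma measurable_residual_le0 x k :
  measurable [set w | residual x (s w) k <= 0].
Proof.
by apply: (measurable_le (g := cst 0)) => //; exact: measurable_residual.
Qed.

Lemma measurable_shortage x n : measurable [set w | shortage x (s w) n].
Proof.
rewrite (_ : [set _ | _] = \bigcup_(m in [set m | (n <= m <= N)%N])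
    [set w | residual x (s w) m <= 0]).
  by apply: bigcup_measurable => m _; exact: measurable_residual_le0.
apply/seteqP; split=> w /=.
  by move=> /shortageP[m [nm mN mx]]; exists m => //=; rewrite nm.
by move=> [m /= /andP[nm mN] mx]; apply/shortageP; exists m.
Qed.

Lemma measurable_fun_shortage x n :
  measurable_fun [set: Omega] (fun w => (shortage x (s w) n)%:R : R).
Proof.
rewrite (_ : (fun _ => _) = \1_[set w | shortage x (s w) n]).
  exact/measurable_indicP/measurable_shortage.
by apply/funext => w; rewrite indicE mem_setE.
Qed.

Lemma integrable_shortage x n :
  P.-integrable [set: Omega] (EFin \o (fun w => (shortage x (s w) n)%:R : R)).
Proof.
apply: (@integrable_bounded _ _ _ P _ 1) (measurable_fun_shortage x n) _ => w.
by case: shortage; rewrite /= ?normr0 ?normr1.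
Qed.

(** The events summed in the price split a shortage after the deadline according to the first time
    the residual is nonpositive. *)
Lemma zetaE (c0 : R) x (k : 'I_N) : tnth (zeta s c0 x) k =
  c0 * fine (P [set w | shortage x (s w) k.+1]).
Proof.
rewrite tnth_mktuple; congr (c0 * _).
(* Shortages visible by time [T]; each induction step on [T] adds the disjoint event [F] that the
   first one occurs at [T.+1]. *)
pose H T := [set w | exists m, [/\ (k < m)%N, (m <= T)%N & residual x (s w) m <= 0]].
have mH T : measurable (H T).
  rewrite (_ : H T = \bigcup_(m in [set m | (k < m <= T)%N])
      [set w | residual x (s w) m <= 0]).
    by apply: bigcup_measurable => m _; exact: measurable_residual_le0.
  apply/seteqP; split=> w /=.
    by move=> [m [nm mN mx]]; exists m => //=; rewrite nm.
  by move=> [m /= /andP[nm mN] mx]; exists m.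
suff HE T : (k < T)%N -> fine (P [set w | residual x (s w) k.+1 <= 0]) +
   \sum_(k.+2 <= t < T.+1) fine (P [set w |
     (forall m, (k.+1 <= m < t)%N -> 0 < residual x (s w) m) /\
            residual x (s w) t <= 0]) = fine (P (H T)).
  rewrite HE ?(leq_ltn_trans _ (ltn_ord k))//.
  congr (fine (P _)); apply/seteqP.
  by split=> w /=; [move=> ?; apply/shortageP|move/shortageP].
elim: T => // T IH; rewrite ltnS leq_eqVlt => /predU1P[kT|kT].
  rewrite -kT big_geq// addr0; congr (fine (P _)); apply/seteqP; split=> w /=.
    by exists k.+1.
  move=> [m [km mk mx]]; have mE : m = k.+1 by apply/eqP; rewrite eqn_leq mk.
  by move: mx; rewrite mE.
rewrite big_nat_recr//= addrA IH//.
set F := [set w | _ /\ _].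
have HF : H T.+1 = H T `|` F.
  apply/seteqP; split=> w /=.
    move=> [m [km + mx]]; rewrite leq_eqVlt => /predU1P[mT|mT]; last first.
      by left; exists m.
    have [[n [kn nT nx]]|nH] := pselect (H T w); first by left; exists n.
    right; split; last by move: mx; rewrite mT.
    move=> n /andP[kn nT]; rewrite ltNge; apply/negP => nx; apply: nH.
    by exists n.
  move=> [[m [km mT mx]]|[_ Tx]]; first by exists m; split=> //; exact: leqW.
  by exists T.+1; split=> //; exact: ltnW.
have mF : measurable F.
  rewrite (_ : F = [set w | residual x (s w) T.+1 <= 0] `\` H T).
    by apply: measurableD => //; exact: measurable_residual_le0.
  apply/seteqP; split=> w /=.
    move=> [pos Tx]; split=> // -[m [km mT mx]].
    by have := pos m; rewrite km ltnS mT ltNge mx => /(_ isT).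
  move=> [Tx nH]; split=> // n /andP[kn nT]; rewrite ltNge; apply/negP => nx.
  by apply: nH; exists n.
rewrite HF measureU//.
  by rewrite fineD// fin_num_measure.
apply/seteqP; split=> w //= [[m [km mT mx]] [pos _]].
by have := pos m; rewrite km ltnS mT ltNge mx => /(_ isT).
Qed.

Lemma zeta_Rintegral (c0 : R) x (k : 'I_N) : tnth (zeta s c0 x) k =
  c0 * \int[P]_w (shortage x (s w) k.+1)%:R.
Proof.
rewrite zetaE; congr (c0 * _); rewrite /Rintegral.
congr fine; rewrite -[X in P X]setIT -integral_indic//; last exact: measurable_shortage.
by apply: eq_integral => w _; rewrite indicE mem_setE.
Qed.

(** * Firm supply of a feasible policy as a random variable *)

Section policy.
Variables (S : interval R) (sigma : inter_policy R N) (y : N.-tuple R).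
Hypothesis hs : forall w (k : 'I_N), tnth (s w) k \in S.
Hypothesis fs : feasible_inter S sigma.
Hypothesis y0 : nonneg_vec y.

(** A policy is measurable only on [Zset k] times [S], so the induction composes it with a state
    that is shown to stay in this domain. *)
Lemma measurable_policy k : (k < N)%N ->
  [/\ measurable_fun [set: Omega] (fun w => unmet sigma y (s w) k),
      measurable_fun [set: Omega] (fun w => intermittent sigma y (s w) k)
    & measurable_fun [set: Omega] (fun w => firm sigma y (s w) k)].
Proof.
have step n : (n < N)%N ->
    measurable_fun [set: Omega] (fun w => unmet sigma y (s w) n) ->
    measurable_fun [set: Omega] (fun w => intermittent sigma y (s w) n) /\
    measurable_fun [set: Omega] (fun w => firm sigma y (s w) n).
  move=> nN mz; have [mmu mnu _] := fs nN.
  set D := [set p : N.-tuple R * R | _ /\ _] in mmu mnu.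
  have mD : measurable D.
    rewrite (_ : D = Zset n `*` [set` S]).
      by apply: measurableX; [exact: measurable_Zset|exact: measurable_itv].
    by apply/seteqP; split.
  have zD : (fun w => (unmet sigma y (s w) n, (s w)`_n)) @` [set: Omega] `<=` D.
    move=> _ [w _ <-]; split=> /=.
      exact: unmet_Zset fs y0 (hs w) (ltnW nN).
    by rewrite -(tnth_nth 0 (s w) (Ordinal nN)).
  have mp : measurable_fun [set: Omega] (fun w => (unmet sigma y (s w) n, (s w)`_n)).
    by apply: measurable_fun_pair => //; exact: measurable_supply.
  by split; [exact: measurable_comp mD zD mmu mp|exact: measurable_comp mD zD mnu mp].
move=> kN; suff mz : measurable_fun [set: Omega] (fun w => unmet sigma y (s w) k).
  by have [] := step k kN mz.
elim: k kN => [|k IH] kN; first exact: measurable_cst.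
have mz := IH (ltnW kN); have [mu_ mv_] := step k (ltnW kN) mz.
apply/measurable_fun_tnthP => j.
rewrite (_ : _ \o _ = fun w => tnth (unmet sigma y (s w) k) j -
    tnth (intermittent sigma y (s w) k) j - tnth (firm sigma y (s w) k) j).
  by apply: measurable_funB; first apply: measurable_funB;
    exact: (measurableT_comp (measurable_tnth j)).
by apply/funext => w /=; rewrite !tnth_mktuple.
Qed.

Lemma measurable_firm k j : (k < N)%N ->
  measurable_fun [set: Omega] (fun w => tnth (firm sigma y (s w) k) j).
Proof.
by move=> kN; have [_ _ mv] := measurable_policy kN;
  exact: (measurableT_comp (measurable_tnth j)).
Qed.

Definition firm_total w : R :=
  \sum_(k < N) \sum_(j < N) tnth (firm sigma y (s w) k) j.

Lemma firm_total_ge0 w : 0 <= firm_total w.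
Proof.
apply: sumr_ge0 => k _; apply: sumr_ge0 => j _.

exact: (firm_ge0 fs y0 (hs w) j (ltn_ord k)).
Qed.

Lemma measurable_firm_total : measurable_fun [set: Omega] firm_total.
Proof.
by apply: measurable_sum => k; apply: measurable_sum => j; exact: measurable_firm.
Qed.

Lemma integrable_firm_total : P.-integrable [set: Omega] (EFin \o firm_total).
Proof.
apply: (@integrable_bounded _ _ _ P _ (\sum_(k < N) \sum_(j < N) tnth y j))
  measurable_firm_total _ => w.
rewrite ger0_norm ?firm_total_ge0//; apply: ler_sum => k _; apply: ler_sum => j _.
exact: (firm_le fs y0 (hs w) j (ltn_ord k)).
Qed.

Lemma firm_costE (c0 : R) : 0 <= c0 ->
  firm_cost s c0 y sigma = (c0 * \int[P]_w firm_total w)%:E.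
Proof.
move=> c00.
have E k : (k < N)%N -> ('E_P[fun w => dotv [tuple c0 | _ < N] (firm sigma y (s w) k)] =
    \int[P]_w (c0 * \sum_(j < N) tnth (firm sigma y (s w) k) j)%:E)%E.
  move=> kN; rewrite unlock; apply: eq_integral => w _; congr EFin.
  by rewrite /dotv mulr_sumr; apply: eq_bigr => j _; rewrite tnth_mktuple.
rewrite /firm_cost; under eq_bigr => k _ do rewrite E//.
rewrite -ge0_integral_sum//; last 2 first.
- move=> k; apply/measurable_EFinP; apply: measurable_funM => //.
  by apply: measurable_sum => j; exact: measurable_firm.
- move=> k w _; rewrite lee_fin mulr_ge0// sumr_ge0// => j _.
  exact: (firm_ge0 fs y0 (hs w) j (ltn_ord k)).
rewrite -RintegralZl//; last exact: integrable_firm_total.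
rewrite /Rintegral fineK; last first.
  apply: integrable_fin_num => //; under [X in integrable _ _ X]eq_fun do rewrite EFinM.
  exact: integrableZl integrable_firm_total.
apply: eq_integral => w _; rewrite sumEFin; congr EFin.
by rewrite /firm_total mulr_sumr.
Qed.

End policy.
End supply.

(** * Integrals over consumers *)

(** The integral of a nonnegative function is a supremum over the simple functions below it, so
    domination suffices. This serves to compare expected utilities directly. *)
Lemma ge0_le_integral_nonmeasurable d (T : measurableType d) (R : realType)
    (mu : {measure set T -> \bar R}) (D : set T) (f g : T -> \bar R) :
  (forall x, D x -> 0 <= f x)%E -> (forall x, D x -> f x <= g x)%E ->
  (\int[mu]_(x in D) f x <= \int[mu]_(x in D) g x)%E.
Proof.
move=> f0 fg; rewrite !ge0_integralE//; last first.
  by move=> x Dx; exact: le_trans (f0 x Dx) (fg x Dx).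
apply: le_ereal_sup => _ [h /= hf <-]; exists h => //= x.
by apply: le_trans (hf x) _; exact: lee_restrict.
Qed.

Lemma integrable_sumr d (T : measurableType d) (R : realType)
    (mu : {measure set T -> \bar R}) (D : set T) I (r : seq I) (f : I -> T -> R) :
  measurable D -> (forall i, mu.-integrable D (EFin \o f i)) ->
  mu.-integrable D (EFin \o (fun x => \sum_(i <- r) f i x)).
Proof.
move=> mD fi.
rewrite (_ : _ \o _ = fun x => (\sum_(i <- r) (EFin \o f i) x)%E); last first.
  by apply/funext => x; rewrite /= sumEFin.
exact: integrable_sum.
Qed.

Lemma Rintegral_sumr d (T : measurableType d) (R : realType)
    (mu : {measure set T -> \bar R}) (D : set T) I (r : seq I) (f : I -> T -> R) :
  measurable D -> (forall i, mu.-integrable D (EFin \o f i)) ->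
  \int[mu]_(x in D) (\sum_(i <- r) f i x) = \sum_(i <- r) \int[mu]_(x in D) f i x.
Proof.
move=> mD fi; elim: r => [|i r IH].
  under eq_Rintegral do rewrite big_nil.
  by rewrite Rintegral_cst// mul0r big_nil.
under eq_Rintegral do rewrite big_cons.
by rewrite RintegralD// ?IH ?big_cons//; exact: integrable_sumr.
Qed.

Lemma integrable_mulr d (T : measurableType d) (R : realType)
    (mu : {measure set T -> \bar R}) (D : set T) (f : T -> R) (c : R) :
  measurable D -> mu.-integrable D (EFin \o f) ->
  mu.-integrable D (EFin \o (fun x => f x * c)).
Proof.
move=> mD fi; rewrite (_ : _ \o _ = fun x => (c%:E * (EFin \o f) x)%E).
  exact: integrableZl.
by apply/funext => x /=; rewrite mulrC EFinM.
Qed.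

Lemma integral_weighted_sum d (T : measurableType d) (R : realType)
    (mu : {measure set T -> \bar R}) (m n : nat) (c : 'I_m -> R)
    (f : 'I_m -> 'I_n -> T -> R) :
  (forall k, 0 <= c k) -> (forall k j x, 0 <= f k j x) ->
  (forall k j, measurable_fun [set: T] (f k j)) ->
  (\int[mu]_x (\sum_(k < m) c k * \sum_(j < n) f k j x)%:E =
   \sum_(k < m) (c k)%:E * \sum_(j < n) \int[mu]_x (f k j x)%:E)%E.
Proof.
move=> c0 f0 mf.
transitivity (\int[mu]_x \sum_(k < m) ((c k)%:E * \sum_(j < n) (f k j x)%:E))%E.
  apply: eq_integral => x _; rewrite -sumEFin; apply: eq_bigr => k _.
  by rewrite EFinM sumEFin.
have mfE k j : measurable_fun [set: T] (fun x => (f k j x)%:E).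
  exact/measurable_EFinP.
rewrite ge0_integral_sum//.
- apply: eq_bigr => k _; rewrite ge0_integralZl_EFin//.
  + by rewrite ge0_integral_sum// => j x _; rewrite lee_fin.
  + by move=> x _; apply: sume_ge0 => j _; rewrite lee_fin.
  + exact: emeasurable_sum.
- move=> k; apply: emeasurable_funM => //; exact: emeasurable_sum.
- move=> k x _; rewrite mule_ge0 ?lee_fin//.
  by apply: sume_ge0 => j _; rewrite lee_fin.
Qed.

Section consumers.
Context {R : realType}.
Variables (Theta : {fset ctype R}) (theta : consumer R -> ctype R).
Hypothesis htheta : type_profile Theta theta.

Let block t := [set i | consumers i /\ theta i = t].

(** The consumers are the finite union of the blocks of equal type. *)
Lemma measurable_consumers : measurable (@consumers R).
Proof.
rewrite (_ : consumers = \bigcup_(t in [set` Theta]) block t).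
  by apply: fin_bigcup_measurable => // t _; have [_] := htheta; apply.
apply/seteqP; split=> i.
  by move=> ci; exists (theta i) => //=; have [h _] := htheta; exact: h.
by move=> [t _ []].
Qed.

Lemma eta_consumers : eta (@consumers R) = 1%E.
Proof.
have -> : eta (@consumers R) = lebesgue_measure [set` `[(0 : R), 1]].
  by congr eta; apply/seteqP; split=> i /=; rewrite in_itv.
by rewrite lebesgue_measure_itv /= lte_fin ltr01 oppr0 adde0.
Qed.

Lemma eta_block t : eta (block t) = (rho theta t)%:E.
Proof.
rewrite /rho fineK// ge0_fin_numE ?measure_ge0//.
apply: (@le_lt_trans _ _ (eta (@consumers R))); last by rewrite eta_consumers ltry.
apply: le_measure; rewrite ?inE.
- by have [_] := htheta; apply.
- exact: measurable_consumers.
- by move=> i [].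
Qed.

Lemma integral_types (f : ctype R -> R) : (forall t, t \in Theta -> 0 <= f t) ->
  (\int[eta]_(i in consumers) (f (theta i))%:E)%E =
  (\sum_(t <- Theta) f t * rho theta t)%:E.
Proof.
move=> f0; pose g t i : \bar R := (`|f t| * \1_(block t) i)%:E.
have mb t : measurable (block t) by have [_] := htheta; apply.
have -> : (\int[eta]_(i in consumers) (f (theta i))%:E =
    \int[eta]_(i in consumers) \sum_(t <- Theta) g t i)%E.
  apply: eq_integral => i /set_mem ci.
  have iT : theta i \in Theta by have [h _] := htheta; exact: h.
  rewrite (bigD1_seq (theta i)) ?fset_uniq//= big1 ?adde0.
    by rewrite /g indicE mem_set// mulr1 ger0_norm// f0.
  move=> t ti; rewrite /g indicE memNset ?mulr0//= => -[_ /eqP].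
  by rewrite eq_sym (negbTE ti).
have mc := measurable_consumers.
have mi t : measurable_fun consumers (\1_(block t) : consumer R -> R).
  by apply: measurable_indic; exact: mb.
rewrite ge0_integral_sum//; last first.
- by move=> t i _; rewrite lee_fin mulr_ge0.
- by move=> t; apply/measurable_EFinP; apply: measurable_funM.
rewrite -sumEFin big_seq [RHS]big_seq; apply: eq_bigr => t tT.
under eq_integral do rewrite /g EFinM.
rewrite ge0_integralZl_EFin//; last exact/measurable_EFinP.
rewrite integral_indic// ger0_norm ?f0// EFinM -eta_block; congr (_ * eta _)%E.
by apply/seteqP; split=> i /= [] // [].
Qed.

End consumers.

(** * Utility bounds and truth-telling bundles *)

Section types.
Context {R : realType} {N : nat}.
Variable Theta : {fset ctype R}.
Implicit Types (t : ctype R) (u : R -> R) (p : N.-tuple R).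

Lemma utility_max t u : utility_assumption t u -> 0 < max_demand t ->
  u (max_demand t) = marg_utility t * max_demand t.
Proof. by move=> [_ _ _ -> _] q0; rewrite divfK// gt_eqF. Qed.

(** An affine majorant of slope [c] touching the utility at maximum demand [q]. The slack is at
    least [(R - c)(q - y)] below [q] and equals [c (y - q)] above. The slopes used later are 0 and
    [c0], so this is where [R >= c0] enters. *)
Lemma utility_le t u (c y : R) : utility_assumption t u -> 0 < max_demand t ->
  0 <= c <= marg_utility t -> 0 <= y ->
  u y <= (marg_utility t - c) * max_demand t + c * y.
Proof.
move=> hu q0 /andP[c0 cm] y0; have [_ _ ule _ ucst] := hu.
have [yq|qy] := leP y (max_demand t).
  apply: le_trans (ule y y0 yq) _; rewrite -subr_ge0.
  rewrite [X in 0 <= X](_ : _ = (marg_utility t - c) * (max_demand t - y)).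
    by rewrite mulr_ge0 ?subr_ge0.
  by ring.
rewrite (ucst _ (ltW qy)) (utility_max hu q0).
rewrite -subr_ge0 [X in 0 <= X](_ : _ = c * (y - max_demand t)).
  by rewrite mulr_ge0// subr_ge0 ltW.
by ring.
Qed.

Lemma truthfulE t j : tnth (truthful N t) j = max_demand t * (j.+1 == deadline t)%:R.
Proof. by rewrite tnth_mktuple; case: eqP => _; rewrite ?mulr1 ?mulr0. Qed.

Lemma sum_truthful t (k : 'I_N) (F : 'I_N -> R) : k.+1 = deadline t ->
  \sum_(j < N) F j * tnth (truthful N t) j = F k * max_demand t.
Proof.
move=> kt; rewrite (bigD1 k)//= big1 ?addr0 => [|j jk].
  by rewrite truthfulE kt eqxx mulr1.
by rewrite truthfulE -kt eqSS val_eqE (negbTE jk) !mulr0.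
Qed.

Lemma deadline_ord t : type_wf N t -> exists k : 'I_N, k.+1 = deadline t.
Proof.
move=> [/andP[t0 tN] _ _]; have kN : ((deadline t).-1 < N)%N by rewrite prednK.
by exists (Ordinal kN); rewrite /= prednK.
Qed.

Lemma truthful_action t : type_wf N t -> t \in Theta -> action Theta (truthful N t).
Proof.
move=> wt tT; have [k kt] := deadline_ord wt; have [_ _ q0] := wt; split.
  by move=> j; rewrite truthfulE mulr_ge0// ltW.
under eq_bigr do rewrite -[tnth _ _]mul1r.
rewrite (sum_truthful (fun=> 1) kt) mul1r.
exact: le_bigmax_seq.
Qed.

Lemma dotv_truthful_demand (theta : consumer R -> ctype R) p :
  dotv p (truthful_demand N Theta theta) =
  \sum_(t <- Theta) dotv p (truthful N t) * rho theta t.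
Proof.
rewrite /dotv; under eq_bigr do rewrite tnth_mktuple mulr_sumr.
rewrite exchange_big; apply: eq_bigr => t _; rewrite mulr_suml.
by apply: eq_bigr => j _; rewrite truthfulE; ring.
Qed.

End types.

(** * Truth-telling and supplier optimality *)

Lemma Rintegral_prob_cst d (T : measurableType d) (R : realType)
    (P : probability T R) (r : R) : \int[P]_x cst r x = r.
Proof. by have := expectation_cst P r; rewrite unlock /Rintegral => ->. Qed.

Section market.
Context {R : realType} {N : nat} {d : measure_display} {Omega : measurableType d}.
Variables (P : probability Omega R) (s : {RV P >-> N.-tuple R}).
Variables (S : interval R) (c0 : R).
Variables (Theta : {fset ctype R}) (theta : consumer R -> ctype R).
Variables (U : ctype R -> R -> R).
Hypothesis hc0 : 0 < c0.
Hypothesis hS : forall r, r \in S -> 0 <= r.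
Hypothesis hs : forall w (k : 'I_N), tnth (s w) k \in S.
Hypothesis hTheta : forall t, t \in Theta -> type_wf N t.
Hypothesis hU : forall t, t \in Theta -> utility_assumption t (U t).
Hypothesis hR : forall t, t \in Theta -> c0 <= marg_utility t.
Hypothesis htheta : type_profile Theta theta.
Implicit Types (x y a p : N.-tuple R) (sigma : inter_policy R N).

Lemma supply_ge0 w : nonneg_vec (s w).
Proof. by move=> j; exact: hS (hs w j). Qed.

Lemma theta_in i : consumers i -> theta i \in Theta.
Proof. by have [h _] := htheta; exact: h. Qed.

(* The pathwise price of class [j] is the cost of one more unit of demand in that
   class: firm supply when a shortage follows its deadline, else nothing. *)
Definition path_price x w (j : 'I_N) : R := c0 * (shortage x (s w) j.+1)%:R.

Lemma integrable_path_payment x a :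
  P.-integrable [set: Omega]
    (EFin \o (fun w => \sum_(j < N) path_price x w j * tnth a j)).
Proof.
apply: integrable_sumr => // j.
rewrite (_ : (fun w => _) = fun w => (shortage x (s w) j.+1)%:R * (c0 * tnth a j)).
  by apply: integrable_mulr => //; exact: integrable_shortage.
by apply/funext => w; rewrite /path_price; ring.
Qed.

Lemma Rintegral_path_payment x a :
  \int[P]_w (\sum_(j < N) path_price x w j * tnth a j) = dotv (zeta s c0 x) a.
Proof.
have E (j : 'I_N) : (fun w => path_price x w j * tnth a j) =
    (fun w => (shortage x (s w) j.+1)%:R * (c0 * tnth a j)).
  by apply/funext => w; rewrite /path_price; ring.
rewrite Rintegral_sumr//; last first.
  by move=> j; rewrite E; apply: integrable_mulr => //; exact: integrable_shortage.
apply: eq_bigr => j _; rewrite E RintegralZr//; last exact: integrable_shortage.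
by rewrite zeta_Rintegral; ring.
Qed.

Lemma path_price_bounds x w j : 0 <= path_price x w j <= c0.
Proof. by rewrite /path_price; case: shortage; rewrite /= ?mulr1 ?mulr0 ?lexx ltW. Qed.

Lemma zeta_price_bundle x : price_bundle (zeta s c0 x).
Proof.
split=> [j|i j ij]; rewrite !zeta_Rintegral.
  by rewrite mulr_ge0 ?(ltW hc0)// Rintegral_ge0.
rewrite ler_wpM2l ?(ltW hc0)//; apply: le_Rintegral => //; try exact: integrable_shortage.
move=> w _; have := @shortage_mono _ _ x (s w) i.+1 j.+1 ij.
by case: (shortage _ _ j.+1) => [->//|_]; rewrite ?ler01// ler0n.
Qed.

Lemma path_payment_truthful x w t : t \in Theta ->
  \sum_(j < N) path_price x w j * tnth (truthful N t) j =
  c0 * (shortage x (s w) (deadline t))%:R * max_demand t.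
Proof.
by move=> tT; have [k kt] := deadline_ord (hTheta tT); rewrite (sum_truthful _ kt) -kt.
Qed.

Lemma EFin_Rintegral (f : Omega -> R) : P.-integrable [set: Omega] (EFin \o f) ->
  (\int[P]_w (f w)%:E)%E = (\int[P]_w f w)%:E.
Proof. by move=> fi; rewrite /Rintegral fineK//; exact: integrable_fin_num. Qed.

(** * One consumer: deviations and truth-telling *)

Section consumer.
Variables (lam : intra_policy R N) (x : N.-tuple R) (i : consumer R).
Hypothesis x0 : nonneg_vec x.
Hypothesis ci : consumers i.

Let t := theta i.

Lemma received_ge0 sigma a w : feasible_intra s Theta sigma lam ->
  action Theta a -> 0 <= received lam (deadline t) i x a (s w).
Proof.
move=> hlam aA; have [/andP[_ tN] _ _] := hTheta (theta_in ci).
apply: sumr_ge0 => k _; apply: sumr_ge0 => j _.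
exact: (intra_nonneg hlam w (leq_trans (ltn_ord k) tN) ci x0 aA).
Qed.

(** A charged class delivers at most its demand. An uncharged class delivers nothing by the
    deadline: early service would keep the residuals positive up to its own deadline and so move the
    shortage beyond it, making the class charged. *)
Lemma received_covered a w : feasible_intra s Theta (edf N) lam ->
  action Theta a -> shortage x (s w) (deadline t) ->
  received lam (deadline t) i x a (s w) <=
    \sum_(j < N) (shortage x (s w) j.+1)%:R * tnth a j.
Proof.
move=> hlam aA gk; have [/andP[_ tN] _ _] := hTheta (theta_in ci).
have lam0 k (j : 'I_N) : (k < N)%N -> 0 <= tnth (lam k i x a (s w)) j.
  by move=> kN; exact: (intra_nonneg hlam).
rewrite /received exchange_big; apply: ler_sum => j _ /=.
rewrite (big_ord_widen _ (fun k => tnth (lam k i x a (s w)) j) tN).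
case gj : (shortage x (s w) j.+1).
  rewrite mul1r; apply: le_trans (intra_demand hlam w j ci x0 aA).
  by rewrite big_mkcond; apply: ler_sum => k _; case: ifP => // _; exact: lam0.
rewrite mul0r big1// => k kt.
(* Coordinate [j] has deadline [j.+1], so an uncharged class falls due strictly after the consumer's
   deadline. *)
have tj : (deadline t <= j)%N.
  by rewrite leqNgt; apply/negP => jt; move: gj; rewrite (shortage_mono jt gk).
have kj : (k < j)%N by exact: leq_trans tj.
apply: (intra_available hlam kj ci x0 aA).
(* Before its last period a class gets no firm supply under EDF, so only intermittent supply must be
   excluded. *)
rewrite edf_firmE// ?ltn_eqF ?addr0//; last exact: supply_ge0.
have [u0 _ _ _] := policy_Uset (edf_feasible hS) x0 (hs w) (ltn_ord k).
have := u0 j; rewrite /= le_eqVlt => /predU1P[//|u_gt0].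
suff : shortage x (s w) j.+1 by rewrite gj.
apply: shortage_cross gk => [||m /andP[tm mj]].
- exact: leqW.
- exact: leqW (ltn_ord j).
- apply: (edf_early_residual x0 (supply_ge0 w) kj u_gt0).
  by rewrite (leq_trans kt tm).
Qed.


(** The bound holds along every path. After a shortage, slope [c0] in [utility_le] and
    [received_covered] bound the utility; without one, the truthful bundle is free and already
    yields maximal utility. *)
Lemma expected_utility_le a : feasible_intra s Theta (edf N) lam ->
  action Theta a ->
  ('E_P[fun w => U t (received lam (deadline t) i x a (s w))] <=
   (U t (max_demand t) - dotv (zeta s c0 x) (truthful N t)
    + dotv (zeta s c0 x) a)%:E)%E.
Proof.
move=> hlam aA; have tT := theta_in ci; have ut := hU tT.
have [_ _ q0] := hTheta tT; have [a0 _] := aA.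
pose pay b w := \sum_(j < N) path_price x w j * tnth b j.
have ipay b : P.-integrable [set: Omega] (EFin \o pay b).
  exact: integrable_path_payment.
have icst r : P.-integrable [set: Omega] (EFin \o cst r).
  exact: finite_measure_integrable_cst.
have i1 : P.-integrable [set: Omega]
    (EFin \o (fun w => U t (max_demand t) - pay (truthful N t) w)).
  by have := integrableB measurableT (icst (U t (max_demand t))) (ipay (truthful N t)).
have i2 : P.-integrable [set: Omega]
    (EFin \o (fun w => U t (max_demand t) - pay (truthful N t) w + pay a w)).
  by have := integrableD measurableT i1 (ipay a).
have -> : U t (max_demand t) - dotv (zeta s c0 x) (truthful N t)
      + dotv (zeta s c0 x) a =
    \int[P]_w (U t (max_demand t) - pay (truthful N t) w + pay a w).
  rewrite (RintegralD measurableT i1 (ipay a)).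
  rewrite (RintegralB measurableT (icst _) (ipay _)).
  by rewrite (Rintegral_prob_cst P) !Rintegral_path_payment.
rewrite unlock -EFin_Rintegral//.
apply: ge0_le_integral_nonmeasurable => w _; rewrite lee_fin.
  by have [h _ _ _ _] := ut; apply: h; exact: (received_ge0 w hlam).
rewrite /pay path_payment_truthful// (utility_max ut q0).
have X0 := received_ge0 w hlam aA.
case gk : (shortage x (s w) (deadline t)).
  have := utility_le ut q0 _ X0 (c := c0).
  rewrite ltW//= hR// => /(_ isT) /le_trans; apply.
  rewrite mulr1 mulrBl lerD2l (_ : \sum_(j < N) _ =
    c0 * \sum_(j < N) (shortage x (s w) j.+1)%:R * tnth a j).
    by rewrite ler_wpM2l ?(ltW hc0)//; exact: received_covered.
  by rewrite mulr_sumr; apply: eq_bigr => j _; rewrite mulrA.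
rewrite mulr0 mul0r subr0; apply: ler_wpDr.
  apply: sumr_ge0 => j _; rewrite mulr_ge0//.
  by have /andP[] := path_price_bounds x w j.
have := utility_le ut q0 _ X0 (c := 0); rewrite mul0r subr0 addr0; apply.
by rewrite lexx (le_trans (ltW hc0))// hR.
Qed.

(** The delivery guarantee squeezes the energy received between two sums that both equal the maximum
    demand, almost surely. *)
Lemma expected_utility_truthful sigma : feasible_intra s Theta sigma lam ->
  ('E_P[fun w => U t (received lam (deadline t) i x (truthful N t) (s w))] =
  (U t (max_demand t))%:E)%E.
Proof.
move=> hlam; have tT := theta_in ci; have ut := hU tT.
have wt := hTheta tT; have [tN R0 q0] := wt; have [k kt] := deadline_ord wt.
have aA := truthful_action wt tT.
have UX w : 0 <= U t (received lam (deadline t) i x (truthful N t) (s w))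
    <= U t (max_demand t).
  have X0 := received_ge0 w hlam aA; have [U0 _ _ _ _] := ut; rewrite U0//=.
  rewrite (utility_max ut q0).
  have := utility_le ut q0 _ X0 (c := 0); rewrite mul0r subr0 addr0; apply.
  by rewrite lexx.
have Uq0 : 0 <= U t (max_demand t) by have [U0 _ _ _ _] := ut; rewrite U0// ltW.
have [A [mA PA0 subA]] := intra_guarantee hlam tN ci x0 aA.
rewrite unlock; apply/eqP; rewrite eq_le; apply/andP; split.
  rewrite -[leRHS](expectation_cst P) unlock.
  apply: ge0_le_integral_nonmeasurable => w _; rewrite lee_fin;
    by have /andP[] := UX w.
(* For the lower bound, the constant is integrated off the null set [A] containing the paths where
   the guarantee fails. *)
have -> : (U t (max_demand t))%:E =
    (\int[P]_w (U t (max_demand t) * \1_(~` A) w)%:E)%E.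
  under eq_integral do rewrite EFinM.
  rewrite ge0_integralZl_EFin//; last first.
    by apply/measurable_EFinP; apply: measurable_indic; exact: measurableC.
  rewrite integral_indic//; last exact: measurableC.
  have PA1 : P (~` A) = 1%E by have := probability_setC P mA; rewrite PA0 sube0.
  by rewrite setIT -[LHS]mule1; congr (_ * _)%E; exact/esym.
apply: ge0_le_integral_nonmeasurable => w _; rewrite lee_fin ?mulr_ge0//.
have [wA|nA] := pselect (A w).
  by rewrite indicE memNset ?mulr0; [have /andP[] := UX w|move=> /(_ wA)].
suff -> : received lam (deadline t) i x (truthful N t) (s w) = max_demand t.
  by rewrite indicE ler_piMr// lern1; case: (_ \in _).
have : ~ ~ (\sum_(t0 < N | (t0 < deadline t)%N) tnth (truthful N t) t0 <=
    received lam (deadline t) i x (truthful N t) (s w) <=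
    \sum_(t0 < N) tnth (truthful N t) t0).
  by move=> h; apply: nA; exact: subA.
move=> /contrapT; rewrite big_mkcond/=.
rewrite (eq_bigr (fun j : 'I_N =>
    (j < deadline t)%:R * tnth (truthful N t) j)); last first.
  by move=> j _; case: ltnP; rewrite ?mul1r ?mul0r.
rewrite (sum_truthful _ kt) -kt ltnSn mul1r kt.
rewrite (eq_bigr (fun j : 'I_N => 1 * tnth (truthful N t) j)); last first.
  by move=> j _; rewrite mul1r.
by rewrite (sum_truthful (fun=> 1) kt) mul1r -eq_le => /eqP.
Qed.

End consumer.

Lemma truthful_dominant lam i : feasible_intra s Theta (edf N) lam -> consumers i ->
  dominant_strategy s Theta theta U lam (zeta s c0) i (truthful N).
Proof.
move=> hlam ci; split; first by move=> t tT; exact: truthful_action (hTheta tT) tT.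
move=> phi x hphi x0; rewrite /payoff (expected_utility_truthful x0 ci hlam).
rewrite leeBlDr// -EFinB -EFinD.
exact: expected_utility_le hlam (hphi _ (theta_in ci)).
Qed.

(** [weighted_supply] with the shortage indicators of [x] as weights; [edf_firm_total] then trades
    the weighted supply for weighted demand minus EDF purchases. *)
Lemma weighted_delivered_le x y sigma w : nonneg_vec x -> nonneg_vec y ->
  feasible_inter S sigma ->
  \sum_(k < N) (shortage x (s w) k.+1)%:R * \sum_(j < N) delivered sigma y (s w) k j <=
  \sum_(j < N) (shortage x (s w) j.+1)%:R * tnth x j
    - firm_total s (edf N) x w + firm_total s sigma y w.
Proof.
move=> x0 y0 fs; rewrite {1}/firm_total edf_firm_total//; last exact: supply_ge0.
have := weighted_supply fs y0 (hs w) (g := fun k => (shortage x (s w) k)%:R).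
move=> /(_ _)/le_trans -> //; first by move=> k; case: shortage; rewrite /= ?lexx ler01.
rewrite lerD2r -sumrB; apply: ler_sum => k _; rewrite (tnth_nth 0) -mulrBr.
by rewrite opprB addrC subrK.
Qed.

(** The expectation of a pathwise inequality obtained by chaining [weighted_demand] and
    [weighted_delivered_le]; the shortage indicators are admissible weights because they decrease in
    time. *)
Lemma edf_cost_subgradient x y sigma : nonneg_vec x -> nonneg_vec y ->
  feasible_inter S sigma ->
  c0 * \int[P]_w firm_total s (edf N) x w + dotv (zeta s c0 x) y
    - dotv (zeta s c0 x) x <= c0 * \int[P]_w firm_total s sigma y w.
Proof.
move=> x0 y0 fs; have fe : feasible_inter S (edf N) by exact: edf_feasible.
have ie := integrable_firm_total hs fe x0; have is_ := integrable_firm_total hs fs y0.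
pose pay b w := \sum_(j < N) path_price x w j * tnth b j.
have ipay b : P.-integrable [set: Omega] (EFin \o pay b).
  exact: integrable_path_payment.
have imul f : P.-integrable [set: Omega] (EFin \o f) ->
    P.-integrable [set: Omega] (EFin \o (fun w => c0 * f w)).
  by move=> fi; apply: eq_integrable (integrable_mulr c0 measurableT fi) => // w _ /=;
    rewrite mulrC.
have i1 : P.-integrable [set: Omega]
    (EFin \o (fun w => c0 * firm_total s (edf N) x w + pay y w)).
  by have := integrableD measurableT (imul _ ie) (ipay y).
have i2 : P.-integrable [set: Omega]
    (EFin \o (fun w => c0 * firm_total s (edf N) x w + pay y w - pay x w)).
  by have := integrableB measurableT i1 (ipay x).
rewrite -!Rintegral_path_payment -!(RintegralZl _ measurableT)//.
rewrite -(RintegralD measurableT (imul _ ie) (ipay y)).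
rewrite -(RintegralB measurableT i1 (ipay x)).
apply: le_Rintegral => //; first exact: imul.
move=> w _.
have wdl := weighted_delivered_le w x0 y0 fs.
have payE b : pay b w = c0 * \sum_(j < N) (shortage x (s w) j.+1)%:R * tnth b j.
  by rewrite mulr_sumr; apply: eq_bigr => j _; rewrite mulrA.
rewrite !payE -mulrDr -mulrBr ler_wpM2l ?(ltW hc0)//.
have /le_trans /(_ wdl) : \sum_(j < N) (shortage x (s w) j.+1)%:R * tnth y j <=
    \sum_(k < N) (shortage x (s w) k.+1)%:R * \sum_(j < N) delivered sigma y (s w) k j.
  apply: (weighted_demand fs y0 (hs w) (g := fun k => (shortage x (s w) k)%:R)).
    by move=> k; exact: ler0n.
  move=> m n mn; have := @shortage_mono _ _ x (s w) m n mn.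
  by case: (shortage _ _ n) => [->//|_]; rewrite ler0n.
by move=> h; lra.
Qed.

Lemma measurable_types (f : ctype R -> R) :
  measurable_fun (@consumers R) (fun i => f (theta i)).
Proof.
move=> _ Y mY; rewrite (_ : _ `&` _ = \bigcup_(t in [set t | t \in Theta /\ Y (f t)])
    [set i | consumers i /\ theta i = t]).
  apply: fin_bigcup_measurable => [|t _]; last by have [_] := htheta; apply.
  by apply: (@sub_finite_set _ _ [set` Theta]) => // t [].
apply/seteqP; split=> i /=.
  by move=> [ci Yi]; exists (theta i) => //; split=> //; exact: theta_in.
by move=> [t [_ Yt] [ci it]]; rewrite it.
Qed.

End market.

(** * Welfare *)

Section welfare.
Context {R : realType} {N : nat} {d : measure_display} {Omega : measurableType d}.
Variables (P : probability Omega R) (s : {RV P >-> N.-tuple R}).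
Variables (S : interval R) (c0 : R).
Variables (Theta : {fset ctype R}) (theta : consumer R -> ctype R).
Variables (U : ctype R -> R -> R).
Hypothesis hc0 : 0 < c0.
Hypothesis hS : forall r, r \in S -> 0 <= r.
Hypothesis hs : forall w (k : 'I_N), tnth (s w) k \in S.
Hypothesis hTheta : forall t, t \in Theta -> type_wf N t.
Hypothesis hU : forall t, t \in Theta -> utility_assumption t (U t).
Hypothesis hR : forall t, t \in Theta -> c0 <= marg_utility t.
Hypothesis htheta : type_profile Theta theta.
Variables (lam : intra_policy R N) (sigma : inter_policy R N).
Variables (act : consumer R -> N.-tuple R) (x y : N.-tuple R).
Hypothesis x0 : nonneg_vec x.
Hypothesis hact : action_profile Theta act.
Hypothesis hy : aggregate act y.
Hypothesis fs : feasible_inter S sigma.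
Hypothesis hlam : feasible_intra s Theta sigma lam.

Lemma aggregate_ge0 : nonneg_vec y.
Proof.
move=> j; rewrite -lee_fin -hy; apply: integral_ge0 => i ci; rewrite lee_fin.
by have [a0 _] := hact.1 i ci; exact: a0.
Qed.

Let y0 := aggregate_ge0.
Let mc := measurable_consumers htheta.

(** Extension by zero outside the consumers, so that Tonelli applies on the full product space. *)
Let L (k j : 'I_N) : consumer R * Omega -> R :=
  (fun iw => tnth (lam k iw.1 y (act iw.1) (s iw.2)) j) \_ (consumers `*` [set: Omega]).

Let L_in k j i w : consumers i -> L k j (i, w) = tnth (lam k i y (act i) (s w)) j.
Proof. by move=> ci; rewrite /L patchE mem_set. Qed.

Let L_out k j i w : ~ consumers i -> L k j (i, w) = 0.
Proof. by move=> ci; rewrite /L patchE memNset// => -[]. Qed.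

Let L_ge0 k j iw : 0 <= L k j iw.
Proof.
case: iw => i w; have [ci|ci] := pselect (consumers i); last by rewrite L_out.
by rewrite L_in//; exact: (intra_nonneg hlam w (ltn_ord k) ci y0 (hact.1 i ci)).
Qed.

Let measurable_L k j : measurable_fun [set: consumer R * Omega] (L k j).
Proof.
have mX : measurable (consumers `*` [set: Omega] : set (consumer R * Omega)).
  by apply: measurableX.
have mf := intra_jointly_measurable hlam (ltn_ord k) hact hy.
have mg := measurableT_comp (measurable_tnth j) mf.
exact: (measurable_restrictT (fun iw : consumer R * Omega =>
  tnth (lam k iw.1 y (act iw.1) (s iw.2)) j) mX).1 mg.
Qed.

Let integral_L k j w :
  (\int[eta]_i (L k j (i, w))%:E)%E = (delivered sigma y (s w) k j)%:E.
Proof.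
transitivity (\int[eta]_(i in consumers) (tnth (lam k i y (act i) (s w)) j)%:E)%E.
  rewrite [RHS]integral_mkcond; apply: eq_integral => i _; rewrite [RHS]patchE.
  have [ci|ci] := pselect (consumers i); first by rewrite mem_set// L_in.
  by rewrite memNset// L_out.
(* The exhaustion clause concerns open classes; for expired ones both sides are 0. *)
have [jk|kj] := ltnP j k; last by rewrite (intra_exhausts hlam w kj hact hy).
rewrite (delivered_expired fs y0 (hs w) jk (ltn_ord k)).
apply: integral0_eq => i ci.
by rewrite (intra_expired hlam w (ltn_ord k) ci y0 (hact.1 i ci) jk).
Qed.

(** The energy delivered to one consumer, each period valued by the shortage indicator of the
    reference demand [x], not of the actual demand [y]. *)
Let F (iw : consumer R * Omega) : R :=
  \sum_(k < N) (shortage x (s iw.2) k.+1)%:R * \sum_(j < N) L k j iw.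

Let F_ge0 iw : 0 <= F iw.
Proof.
by apply: sumr_ge0 => k _; rewrite mulr_ge0// sumr_ge0.
Qed.

Let measurable_F : measurable_fun [set: consumer R * Omega] (EFin \o F).
Proof.
apply/measurable_EFinP; apply: measurable_sum => k; apply: measurable_funM.
  exact: (measurableT_comp (measurable_fun_shortage s x k.+1)).
exact: measurable_sum.
Qed.

Let integral_F w : (\int[eta]_i (F (i, w))%:E)%E =
  (\sum_(k < N) (shortage x (s w) k.+1)%:R *
     \sum_(j < N) delivered sigma y (s w) k j)%:E.
Proof.
have mL k j : measurable_fun [set: consumer R] (fun i => L k j (i, w)).
  exact: (measurable_fun_pair1 w (measurable_L k j)).
have g0 (k : 'I_N) : 0 <= (shortage x (s w) k.+1)%:R :> R by exact: ler0n.
have L0 k j i : 0 <= L k j (i, w) by exact: L_ge0.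
rewrite [LHS](integral_weighted_sum eta g0 L0 mL).
rewrite -sumEFin; apply: eq_bigr => k _; rewrite EFinM -sumEFin.
by congr (_ * _)%E; apply: eq_bigr => j _; exact: integral_L.
Qed.


(** The surplus of a truthful consumer at the reference prices. *)
Let b t := U t (max_demand t) - dotv (zeta s c0 x) (truthful N t).

Let b_ge0 t : t \in Theta -> 0 <= b t.
Proof.
move=> tT; have [_ _ q0] := hTheta tT; have [k kt] := deadline_ord (hTheta tT).
rewrite /b (utility_max (hU tT) q0) subr_ge0 /dotv (sum_truthful _ kt).
rewrite ler_wpM2r ?(ltW q0)// (le_trans _ (hR tT))//.
rewrite zetaE ler_piMr ?(ltW hc0)// -lee_fin fineK ?fin_num_measure//; last first.
  exact: measurable_shortage.
by apply: probability_le1; exact: measurable_shortage.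
Qed.

(** [utility_le] with the random slope [c0] times the shortage indicator at the deadline. The
    constant part has mean [b]; energy arriving by the deadline has at least that indicator as its
    weight in [F], by monotonicity of shortages. *)
Let expected_utility_le_F i : consumers i ->
  ('E_P[fun w => U (theta i) (received lam (deadline (theta i)) i y (act i) (s w))] <=
  (b (theta i))%:E + c0%:E * \int[P]_w (F (i, w))%:E)%E.
Proof.
move=> ci; have tT := theta_in htheta ci; have ut := hU tT.
have [/andP[_ tN] _ q0] := hTheta tT; set t := theta i in tT ut q0 tN *.
have aA := hact.1 i ci.
pose h w : R := U t (max_demand t) -
  \sum_(j < N) path_price s c0 x w j * tnth (truthful N t) j.
have hE w : h w =
    (marg_utility t - c0 * (shortage x (s w) (deadline t))%:R) * max_demand t.
  by rewrite /h (path_payment_truthful s c0 hTheta)// (utility_max ut q0) -mulrBl.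
have h0 w : 0 <= h w.
  rewrite hE mulr_ge0 ?(ltW q0)// subr_ge0 (le_trans _ (hR tT))//.
  by rewrite ler_piMr ?(ltW hc0)//; case: shortage.
have icst r : P.-integrable [set: Omega] (EFin \o cst r).
  exact: finite_measure_integrable_cst.
have ih : P.-integrable [set: Omega] (EFin \o h).
  by have := integrableB measurableT (icst (U t (max_demand t)))
    (integrable_path_payment s c0 x (truthful N t)).
have -> : (b t)%:E = (\int[P]_w (h w)%:E)%E.
  rewrite EFin_Rintegral// (RintegralB measurableT (icst _)
    (integrable_path_payment s c0 x (truthful N t))).
  by rewrite (Rintegral_prob_cst P) Rintegral_path_payment.
have mFi : measurable_fun [set: Omega] (fun w => (F (i, w))%:E).
  exact: (measurable_fun_pair2 i measurable_F).
rewrite -ge0_integralZl_EFin ?(ltW hc0)//; last by move=> w _; rewrite lee_fin.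
rewrite -ge0_integralD//; last first.
  by apply: emeasurable_funM.
  by move=> w _; rewrite mule_ge0// lee_fin ?(ltW hc0).
  exact: (measurable_int P).
  by move=> w _; rewrite lee_fin.
rewrite unlock; apply: ge0_le_integral_nonmeasurable => w _; rewrite ?lee_fin.
  have [U0 _ _ _ _] := ut; apply: U0.
  exact: (received_ge0 hTheta htheta y0 ci w hlam).
have X0 := received_ge0 hTheta htheta y0 ci w hlam aA.
have := utility_le ut q0 _ X0 (c := c0 * (shortage x (s w) (deadline t))%:R).
rewrite hE => /(_ _)/le_trans; apply.
  rewrite mulr_ge0 ?(ltW hc0)//= (le_trans _ (hR tT))//.
  by rewrite ler_piMr ?(ltW hc0)//; case: shortage.
rewrite lerD2l -mulrA ler_wpM2l ?(ltW hc0)//.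
case gk : (shortage x (s w) (deadline t)); last by rewrite mul0r.
rewrite mul1r /received.
rewrite (big_ord_widen _ (fun k => \sum_(j < N) tnth (lam k i y (act i) (s w)) j) tN).
rewrite big_mkcond; apply: ler_sum => k _; case: ifPn => [kt|_]; last first.
  by rewrite mulr_ge0// sumr_ge0.
rewrite (shortage_mono kt gk) mul1r; apply: ler_sum => j _.
by rewrite L_in.
Qed.

(** Integrating over consumers first turns individual deliveries into class deliveries, to which
    [weighted_delivered_le] applies path by path. *)
Let F_total : (\int[eta]_(i in consumers) \int[P]_w (F (i, w))%:E <=
  (\int[P]_w (\sum_(j < N) (shortage x (s w) j.+1)%:R * tnth x j)
   - \int[P]_w firm_total s (edf N) x w + \int[P]_w firm_total s sigma y w)%:E)%E.
Proof.
have F0 iw : (0 <= (EFin \o F) iw)%E by rewrite lee_fin.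
apply: (@le_trans _ _ (\int[eta]_i \int[P]_w (EFin \o F) (i, w))%E).
  have Fi i : (0 <= \int[P]_w (F (i, w))%:E)%E.
    by apply: integral_ge0 => w _; exact: F0.
  rewrite integral_mkcond.
  apply: ge0_le_integral_nonmeasurable => i _; rewrite patchE.
    by case: ifP => // _; exact: Fi.
  by case: ifP => _; [exact: lexx|exact: Fi].
rewrite (fubini_tonelli (EFin \o F) measurable_F F0).
have fe : feasible_inter S (edf N) by exact: edf_feasible.
have ie := integrable_firm_total hs fe x0; have is_ := integrable_firm_total hs fs y0.
have ig : P.-integrable [set: Omega]
    (EFin \o (fun w => \sum_(j < N) (shortage x (s w) j.+1)%:R * tnth x j)).
  apply: integrable_sumr => // j; apply: integrable_mulr => //.
  exact: integrable_shortage.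
have i1 := integrableB measurableT ig ie.
rewrite -(RintegralB measurableT ig ie).
have i2 := integrableD measurableT i1 is_.
rewrite -(RintegralD measurableT i1 is_) -EFin_Rintegral//.
apply: ge0_le_integral_nonmeasurable => w _.
  by apply: integral_ge0 => i _; exact: F0.
by rewrite [leLHS]integral_F lee_fin; exact: (weighted_delivered_le hS hs w x0 y0 fs).
Qed.

(** The firm cost of [sigma] cancels against the one in [F_total], leaving a bound independent of
    the actions and of the scheduling policy. *)
Lemma welfare_le : (welfare s c0 theta U act y sigma lam <=
  (\sum_(t <- Theta) b t * rho theta t + dotv (zeta s c0 x) x
   - c0 * \int[P]_w firm_total s (edf N) x w)%:E)%E.
Proof.
rewrite /welfare (firm_costE hs fs y0 (ltW hc0)) leeBlDr//.
have mFw : measurable_fun (@consumers R) (fun i => \int[P]_w (F (i, w))%:E)%E.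
  apply: measurable_funTS.
  apply: (measurable_fun_fubini_tonelli_F (EFin \o F) measurable_F).
  by move=> iw; rewrite lee_fin.
have Fw0 i : (0 <= \int[P]_w (F (i, w))%:E)%E.
  by apply: integral_ge0 => w _; rewrite lee_fin.
have c0F : (c0%:E * \int[eta]_(i in consumers) \int[P]_w (F (i, w))%:E <=
   (dotv (zeta s c0 x) x - c0 * \int[P]_w firm_total s (edf N) x w
      + c0 * \int[P]_w firm_total s sigma y w)%:E)%E.
  apply: (@le_trans _ _ (c0%:E *
   (\int[P]_w (\sum_(j < N) (shortage x (s w) j.+1)%:R * tnth x j)
   - \int[P]_w firm_total s (edf N) x w + \int[P]_w firm_total s sigma y w)%:E)%E).
    by apply: lee_wpmul2l F_total; rewrite lee_fin ltW.
  rewrite -EFinM lee_fin -Rintegral_path_payment mulrDr mulrBr !lerD2r.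
  rewrite -RintegralZl//.
    rewrite le_eqVlt; apply/predU1P; left; apply: eq_Rintegral => w _.
    by rewrite mulr_sumr; apply: eq_bigr => j _; rewrite mulrA.
  apply: integrable_sumr => // j; apply: integrable_mulr => //.
  exact: integrable_shortage.
apply: (@le_trans _ _ (\int[eta]_(i in consumers) ((b (theta i))%:E
    + c0%:E * \int[P]_w (F (i, w))%:E))%E).
  apply: ge0_le_integral_nonmeasurable => i ci; last exact: expected_utility_le_F.
  rewrite unlock; apply: integral_ge0 => w _; rewrite lee_fin.
  have [U0 _ _ _ _] := hU (theta_in htheta ci); apply: U0.
  exact: (received_ge0 hTheta htheta y0 ci w hlam (hact.1 i ci)).
have b0 i : consumers i -> (0 <= (b (theta i))%:E)%E.
  by move=> ci; rewrite lee_fin b_ge0//; exact: theta_in ci.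
have mb : measurable_fun (@consumers R) (fun i => (b (theta i))%:E).
  by apply/measurable_EFinP; exact: (measurable_types htheta b).
have cF0 i : consumers i -> (0 <= c0%:E * \int[P]_w (F (i, w))%:E)%E.
  by move=> _; rewrite mule_ge0// lee_fin ltW.
have mcF : measurable_fun (@consumers R) (fun i => c0%:E * \int[P]_w (F (i, w))%:E)%E.
  exact: emeasurable_funM.
rewrite [leLHS](ge0_integralD eta mc b0 mb cF0 mcF).
rewrite ge0_integralZl_EFin ?(ltW hc0)// (integral_types htheta b_ge0).
apply: le_trans (leeD2l _ c0F) _.
by rewrite -EFinD -EFinD lee_fin !addrA.
Qed.

End welfare.

(** * Existence, uniqueness and welfare of the equilibrium *)

Unset Implicit Arguments.

Theorem corollary1 (R : realType) (N : nat) (c0 : R)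
    (d : measure_display) (Omega : measurableType d) (P : probability Omega R)
    (S : interval R) (s : {RV P >-> N.-tuple R})
    (Theta : {fset ctype R}) (U : ctype R -> R -> R)
    (theta : consumer R -> ctype R) (lam : intra_policy R N)
    (hN : (1 <= N)%N) (hc0 : 0 < c0)
    (hS : forall r, r \in S -> 0 <= r)
    (hs : forall w (k : 'I_N), tnth (s w) k \in S)
    (hac : distribution P s `<< @lebesgue_tuple R N)
    (hsupp : compact (law_support s))
    (hTheta : forall t, t \in Theta -> type_wf N t)
    (hU : forall t, t \in Theta -> utility_assumption t (U t))
    (hR : forall t, t \in Theta -> c0 <= marg_utility t)
    (htheta : type_profile Theta theta)
    (hlam : feasible_intra s Theta (edf N) lam) :
  let xstar := truthful_demand N Theta theta in
  let pstar := zeta s c0 xstar in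
  [/\ market_equilibrium s S c0 Theta theta U (edf N) lam (zeta s c0) xstar pstar,
      forall x p,
        market_equilibrium s S c0 Theta theta U (edf N) lam (zeta s c0) x p ->
        x = xstar /\ p = pstar
    & maximizes_welfare s S c0 Theta theta U
        (fun i => truthful N (theta i)) xstar (edf N) lam].
Proof.
move=> xstar pstar.
have x0 : nonneg_vec xstar.
  move=> j; rewrite tnth_mktuple big_seq; apply: sumr_ge0 => t tT.
  have [_ _ q0] := hTheta _ tT.
  by rewrite !mulr_ge0 ?(ltW q0)// fine_ge0// measure_ge0.
have fe : feasible_inter S (edf N) by exact: edf_feasible.
have demand : aggregate (fun i => truthful N (theta i)) xstar.
  move=> j; rewrite (integral_types htheta (f := fun t => tnth (truthful N t) j)).
    rewrite tnth_mktuple; congr EFin; apply: eq_bigr => t _.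
    by rewrite truthfulE mulrAC.
  by move=> t tT; have [a0 _] := truthful_action (hTheta _ tT) tT; exact: a0.
split.
- split=> //.
  + exact: zeta_price_bundle.
  + by move=> i ci; exact: (truthful_dominant hc0 hS hs hTheta hU hR htheta hlam ci).
  + move=> y sigma y0 fs; rewrite /profit (firm_costE hs fs y0 (ltW hc0)).
    rewrite (firm_costE hs fe x0 (ltW hc0)) -!EFinB lee_fin.
    by have := edf_cost_subgradient hc0 hS hs x0 y0 fs; rewrite -/pstar; lra.
(* The truthful aggregate is an integral fixed by the types, so it determines the quantity and,
   through [zeta], the price. *)
- move=> x p [_ _ _ hx -> _ _ _]; suff -> : x = xstar by [].
  apply: eq_from_tnth => j; apply: EFin_inj.
  by rewrite -hx -demand.
- move=> act y sigma lam' hact hy fs hlam'.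
  apply: le_trans (welfare_le hc0 hS hs hTheta hU hR htheta x0 hact hy fs hlam') _.
  rewrite /welfare (firm_costE hs fe x0 (ltW hc0)).
  have -> : (\int[eta]_(i in consumers) 'E_P[fun w => U (theta i)
      (received lam (deadline (theta i)) i xstar (truthful N (theta i)) (s w))] =
    (\sum_(t <- Theta) U t (max_demand t) * rho theta t)%:E)%E.
    rewrite -(integral_types htheta (f := fun t => U t (max_demand t))).
      apply: eq_integral => i /set_mem ci.
      exact: (expected_utility_truthful hTheta hU htheta x0 ci hlam).
    by move=> t tT; have [_ _ q0] := hTheta _ tT; have [U0 _ _ _ _] := hU _ tT;
      exact: U0 (ltW q0).
  (* At [xstar] the revenue splits by type and cancels the payments inside the surplus terms, so the
     bound is the welfare attained. *)
  rewrite -EFinB lee_fin lerD2r dotv_truthful_demand -big_split/=.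
  by apply: ler_sum => t _; rewrite mulrBl subrK.
Qed.
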